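(* Let $\beta_c$ be given by the self-consistency equation $$\beta_c=\sqrt{2\Big(\log 2-\big(\beta_c\,\mathbb{E}[h_1\tanh \beta_c h_1]-\mathbb{E}[\log\cosh\beta_c h_1]\big)\Big)}$$ and let $$E_{\max}=\beta_c+\mathbb{E}[h_1\tanh\beta_c h_1].$$ Then for every $\beta>0$, $\mathbb{P}$-almost surely, $$\lim_{N\to\infty}\frac1N\log\sum_{\sigma\in\Sigma_N}\exp\big(\beta H_N(\sigma)\big)=\begin{cases}\log 2+\frac{\beta^2}{2}+\mathbb{E}[\log\cosh\beta h_1] & \text{if }\beta\le\beta_c,\\[2pt] E_{\max}\,\beta & \text{if }\beta\ge\beta_c.\end{cases}$$
   Context: For $N\in\mathbb{N}$ let $\Sigma_N=\{-1,+1\}^N$. On a probability space $(\Omega,\mathcal{F},\mathbb{P})$ with expectation $\mathbb{E}$ are defined: for each $N$, a family $X_N=(X_N(\sigma),\sigma\in\Sigma_N)$ of i.i.d. centered Gaussian random variables of variance $N$; and a sequence $\vec h=(h_i,i\in\mathbb{N})$ of i.i.d. real random variables independent of the $X_N$'s, with $\mathbb{E}[\exp(t h_1)]<\infty$ for all $t\in\mathbb{R}$. The Hamiltonian is $$H_N(\sigma)=X_N(\sigma)+Y_N(\sigma),\qquad Y_N(\sigma)=\sum_{i=1}^N h_i\sigma_i,\qquad \sigma\in\Sigma_N.$$ *)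

(* Defs.v *)
From HB Require Import structures.
From mathcomp Require Import all_boot all_order all_algebra finmap.
From mathcomp Require Import all_classical all_reals all_analysis.

Set Implicit Arguments.
Unset Strict Implicit.
Unset Printing Implicit Defensive.

Import Order.TTheory GRing.Theory Num.Theory.
Import numFieldNormedType.Exports.

Local Open Scope classical_set_scope.
Local Open Scope ring_scope.

Definition sinh {R : realType} (x : R) : R := (expR x - expR (- x)) / 2.
Definition cosh {R : realType} (x : R) : R := (expR x + expR (- x)) / 2.
Definition tanh {R : realType} (x : R) : R := sinh x / cosh x.

Section families.
Context {d : measure_display} {T : measurableType d} {R : realType}.
Variable P : probability T R.

Definition mutually_independent (I : choiceType) (X : I -> {RV P >-> R}) :=
  forall (J : {fset I}) (B : I -> set R),
    (forall i, measurable (B i)) ->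
    P (\bigcap_(i in [set` J]) (X i @^-1` B i)) =
      (\prod_(i <- J) P (X i @^-1` B i))%E.

(* Laws are compared on measurable sets only: a measure is a function on all
   sets, whose values on non-measurable sets are irrelevant. *)
Definition identically_distributed (I : choiceType) (X : I -> {RV P >-> R}) :=
  forall (i j : I) (B : set R), measurable B ->
    distribution P (X i) B = distribution P (X j) B.

Definition iid (I : choiceType) (X : I -> {RV P >-> R}) :=
  mutually_independent X /\ identically_distributed X.

Definition sigma_of (I : choiceType) (X : I -> {RV P >-> R}) : set (set T) :=
  <<s \bigcup_i preimage_set_system setT (X i) measurable >>.

Definition independent_families (I J : choiceType)
    (X : I -> {RV P >-> R}) (Y : J -> {RV P >-> R}) :=
  forall A B : set T, sigma_of X A -> sigma_of Y B ->
    P (A `&` B) = (P A * P B)%E.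

(* [normal_prob] takes the standard deviation, and is a Gaussian law only when
   that is nonzero. *)
Definition centered_gaussian (v : R) (X : {RV P >-> R}) :=
  forall B : set R, measurable B ->
    distribution P X B = normal_prob 0 (Num.sqrt v) B.

End families.

(* {-1,+1}^N, the sign at site i being encoded by a boolean. *)
Definition config (N : nat) := {ffun 'I_N -> bool}.
Definition spin {R : realType} (N : nat) (s : config N) (i : 'I_N) : R :=
  (-1) ^+ s i.

Section model.
Context {d : measure_display} {T : measurableType d} {R : realType}.
Variable P : probability T R.
Variable X : forall N, config N -> {RV P >-> R}.
(* Sites are numbered from 0, so that h_1 is [h 0]. *)
Variable h : nat -> {RV P >-> R}.

Definition field_energy (N : nat) (s : config N) (w : T) : R :=
  \sum_(i < N) h i w * spin s i.

Definition hamiltonian (N : nat) (s : config N) (w : T) : R :=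
  X s w + field_energy s w.

Definition free_energy (beta : R) (w : T) (N : nat) : R :=
  N%:R^-1 * ln (\sum_(s : config N) expR (beta * hamiltonian s w)).

End model.

Section critical.
Context {d : measure_display} {T : measurableType d} {R : realType}.
Variable P : probability T R.
Variable g : {RV P >-> R}.

(* When all exponential moments of g are finite, both expectations below are
   finite, so that [fine] does not alter them. *)
Definition mean_tanh (beta : R) : R :=
  fine ('E_P[fun w => (g w * tanh (beta * g w))%R])%E.

Definition mean_log_cosh (beta : R) : R :=
  fine ('E_P[fun w => ln (cosh (beta * g w)%R)])%E.

Definition is_critical (betac : R) :=
  betac = Num.sqrt (2 * (ln 2 -
            (betac * mean_tanh betac - mean_log_cosh betac))).

Definition max_energy (betac : R) : R := betac + mean_tanh betac.

End critical.

(* Main.v *)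
Require Import Defs.
From HB Require Import structures.
From mathcomp Require Import all_boot all_order all_algebra finmap.
From mathcomp Require Import all_classical all_reals all_analysis.
From mathcomp Require Import measurable_realfun ring lra.
From Stdlib Require PeanoNat.

Set Implicit Arguments.
Unset Strict Implicit.
Unset Printing Implicit Defensive.

Import Order.TTheory GRing.Theory Num.Theory.
Import numFieldNormedType.Exports.

Local Open Scope classical_set_scope.
Local Open Scope ring_scope.

(** The Hamiltonian is a random energy model in a random field, and the free
    energy is computed by comparing the partition function Z with its mean given
    the field. Write A_N(b) for the logarithm of the sum over s of
    exp (b Y_N(s)); it equals N log 2 plus the sum of the log cosh (b h_i).
    Dividing Z by exp (A_N(b) + N b^2/2) turns it into M, the sum over s of
    p_s * xi_s, where p_s is the Gibbs weight of s in the field alone and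
    xi_s = exp (b X_s - N b^2/2) has mean 1 and is independent of p
    ([free_energyE]). By the strong law A_N(b)/N converges, so everything rests
    on the size of M on the exponential scale. The X_N for different N may be
    arbitrarily correlated: every almost sure statement about M comes from a
    summable bound on probabilities and the Borel-Cantelli lemma.

    Upper bound. Since M has mean 1, Markov's inequality gives
    (1/N) log M <= e eventually, for every e > 0 ([normalized_partition_upper]).
    Hence the limsup of the free energy is at most the annealed pressure
    phi(b) = log 2 + b^2/2 + E[log cosh (b h_1)].

    Lower bound below the critical point. The plain second moment of M explodes
    before betac is reached, so p_s is cut at level exp (-N a) and xi_s at level
    exp (N b), separately, which keeps the two factors independent. The
    fluctuation of the truncated sum then has second moment at most
    exp (-N (a - b)). With q > 1, truncation costs little in the mean provided
    (q - 1) a < q G(beta) - G(q beta) and b > q beta^2/2, where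
    G(x) = phi(x) - x^2/2: the q-th moments control what is cut off. Levels with
    b < a satisfying both exist exactly when phi(q beta) < q phi(beta), and for
    q = betac/beta this is the fact that phi(x)/x decreases strictly on
    ]0, betac] ([annealed_pressure_ray]). So M >= 1/4 eventually
    ([truncated_partition_lower]); the entropy of the field enters only through
    the strong law at beta and at betac.

    Above the critical point. Deterministically, log Z is convex in beta, and
    (log Z)/beta is nonincreasing. The second property extends the upper bound
    at betac to betac E_max (beta/betac). Convexity bounds log Z at beta from
    below by chords through two points below betac, whose slopes tend to
    phi'(betac) = E_max; the resulting line is the tangent to phi at betac,
    which passes through the origin ([critical_chord]).

    The critical point. The self-consistency equation says that
    x phi'(x) - phi(x) + log 2 takes the value log 2 at betac. This function is
    [energy_gap]; it vanishes at 0 and is continuous, strictly increasing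
    and unbounded on the nonnegative axis, hence the unique solution. All properties of phi follow by
    integrating the tangent inequality for log cosh. *)

(** * Convexity of log cosh and of the logarithmic partition function *)

Section hyperbolic.
Context {R : realType}.
Implicit Types u v x : R.

Lemma cosh_gt0 u : 0 < cosh u.
Proof. by rewrite divr_gt0// addr_gt0// expR_gt0. Qed.

(** The ratio cosh v / cosh u is the mean of exp (e (v - u)) for a sign e drawn
    with weight proportional to exp (e u), whose mean is tanh u; Jensen's
    inequality for exp, in the form 1 + x <= exp x, gives the bound. *)
Lemma log_cosh_tangent u v :
  ln (cosh u) + (v - u) * tanh u <= ln (cosh v).
Proof.
have c0 := cosh_gt0 u.
rewrite -ler_expR expRD !lnK ?posrE ?cosh_gt0//.
set t := (v - u) * tanh u.
have p := expR_ge1Dx (v - u - t); have q := expR_ge1Dx (- (v - u) - t).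
have -> : cosh v = (expR u * expR (v - u - t) + expR (- u) * expR (- (v - u) - t))
                   / 2 * expR t.
  rewrite /cosh -!expRD [RHS]mulrAC [in RHS]mulrDl -!expRD.
  congr ((expR _ + expR _) / _); ring.
rewrite ler_pM2r ?expR_gt0// ler_pM2r//.
apply: le_trans (lerD (ler_wpM2l (expR_ge0 u) p) (ler_wpM2l (expR_ge0 (- u)) q)).
have e : (expR u + expR (- u)) * t = (v - u) * (expR u - expR (- u)).
  rewrite /t /tanh /sinh /cosh; field.
  by rewrite gt_eqF// addr_gt0// expR_gt0.
rewrite le_eqVlt; apply/orP; left; apply/eqP.
transitivity (expR u + expR (- u) - (expR u + expR (- u)) * t + (v - u) * (expR u - expR (- u))).
  by rewrite e; ring.
by ring.
Qed.

Lemma tanh0 : tanh (0 : R) = 0.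
Proof. by rewrite /tanh /sinh oppr0 subrr !mul0r. Qed.

Lemma cosh0 : cosh (0 : R) = 1.
Proof. by rewrite /cosh oppr0 expR0; field. Qed.

Lemma log_cosh_ge0 u : 0 <= ln (cosh u).
Proof.
by have := log_cosh_tangent 0 u; rewrite tanh0 cosh0 ln1 mulr0 addr0.
Qed.

Lemma log_cosh_le_abs u : ln (cosh u) <= `|u|.
Proof.
rewrite -ler_expR lnK ?posrE ?cosh_gt0//.
have p : expR u <= expR `|u| by rewrite ler_expR ler_norm.
have q : expR (- u) <= expR `|u| by rewrite ler_expR -normrN ler_norm.
by rewrite /cosh; lra.
Qed.

Lemma abs_tanh_le1 u : `|tanh u| <= 1.
Proof.
have c0 := cosh_gt0 u.
rewrite normrM normrV ?unitfE ?gt_eqF// (gtr0_norm c0) ler_pdivrMr// mul1r.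
have p := expR_gt0 u; have q := expR_gt0 (- u).
by rewrite ler_norml /sinh /cosh; apply/andP; split; lra.
Qed.

Lemma abs_mul_tanh_le (b x : R) : `|x * tanh (b * x)| <= `|x|.
Proof. by rewrite normrM ler_piMr// abs_tanh_le1. Qed.

(** The quantity compared is the Legendre transform of log cosh at the slope
    tanh (b x). Subtracting the tangent inequalities at b x and at c x shows that
    it is nondecreasing. *)
Lemma log_cosh_dual_homo (b c x : R) : 0 <= b -> b <= c ->
  b * (x * tanh (b * x)) - ln (cosh (b * x)) <=
  c * (x * tanh (c * x)) - ln (cosh (c * x)).
Proof.
move=> b0 bc.
have p := log_cosh_tangent (b * x) (c * x).
have q := log_cosh_tangent (c * x) (b * x).
have [->|bnc] := eqVneq b c; first by [].
have dbc : 0 < c - b by rewrite subr_gt0 lt_neqAle bnc.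
have e : 0 <= x * tanh (c * x) - x * tanh (b * x).
  by rewrite -(pmulr_rge0 _ dbc); move: p q; lra.
have := mulr_ge0 b0 e; move: q; lra.
Qed.

Lemma continuous_cosh : continuous (@cosh R).
Proof.
move=> x; apply: cvgM; last exact: cvg_cst.
apply: cvgD; first exact: continuous_expR.
by apply: continuous_comp; [exact: oppr_continuous|exact: continuous_expR].
Qed.

Lemma continuous_log_cosh : continuous (fun u : R => ln (cosh u)).
Proof.
move=> x; apply: continuous_comp; first exact: continuous_cosh.
exact/continuous_ln/cosh_gt0.
Qed.

Lemma continuous_tanh : continuous (@tanh R).
Proof.
move=> x; apply: cvgM; last first.
  by apply: cvgV; [rewrite gt_eqF// cosh_gt0|exact: continuous_cosh].
apply: cvgM; last exact: cvg_cst.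
apply: cvgB; first exact: continuous_expR.
by apply: continuous_comp; [exact: oppr_continuous|exact: continuous_expR].
Qed.

End hyperbolic.

Section log_sum_exp.
Context {R : realType} (I : finType) (i0 : I) (H : I -> R).

Definition log_sum_exp (b : R) : R := ln (\sum_i expR (b * H i)).

Lemma sum_expR_gt0 (f : I -> R) : 0 < \sum_i expR (f i).
Proof.
rewrite (bigD1 i0)//= ltr_pwDl ?expR_gt0// sumr_ge0// => i _; exact: expR_ge0.
Qed.

(** The slope s is the mean of H under the Gibbs measure at b. Having it in
    this form gives convexity without derivatives. *)
Lemma log_sum_exp_tangent (b : R) :
  exists s, forall c, log_sum_exp b + (c - b) * s <= log_sum_exp c.
Proof.
set Z := \sum_i expR (b * H i).
have Z0 : 0 < Z by exact: sum_expR_gt0.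
exists ((\sum_i expR (b * H i) * H i) / Z) => c.
set s := _ / Z.
rewrite /log_sum_exp -/Z -ler_expR expRD !lnK ?posrE ?sum_expR_gt0//.
have -> : \sum_i expR (c * H i) =
    (\sum_i expR (b * H i) * expR ((c - b) * H i - (c - b) * s)) * expR ((c - b) * s).
  rewrite mulr_suml; apply: eq_bigr => i _; rewrite -!expRD; congr expR; ring.
rewrite ler_pM2r ?expR_gt0//.
have -> : Z = \sum_i expR (b * H i) * (1 + ((c - b) * H i - (c - b) * s)).
  transitivity (Z * (1 - (c - b) * s) + (c - b) * \sum_i expR (b * H i) * H i).
    by rewrite /s; field; rewrite gt_eqF.
  rewrite mulr_suml mulr_sumr -big_split; apply: eq_bigr => i _ /=; ring.
by apply: ler_sum => i _; rewrite ler_pM2l ?expR_gt0// expR_ge1Dx.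
Qed.

Lemma log_sum_exp_chord (a b c : R) : a < b -> b <= c ->
  log_sum_exp b + (c - b) * ((log_sum_exp b - log_sum_exp a) / (b - a))
    <= log_sum_exp c.
Proof.
move=> ab bc; have [s hs] := log_sum_exp_tangent b.
apply: le_trans (hs c); rewrite lerD2l ler_wpM2l ?subr_ge0//.
by rewrite ler_pdivrMr ?subr_gt0//; have := hs a; lra.
Qed.

(** Each term exp (b H i) is at most the sum, so that raising the sum to the
    power c / b dominates the sum of the powers: the l^p norms decrease in p. *)
Lemma log_sum_exp_sublinear (b c : R) : 0 < b -> b <= c ->
  log_sum_exp c <= c / b * log_sum_exp b.
Proof.
move=> b0 bc.
rewrite -ler_expR lnK ?posrE ?sum_expR_gt0//.
have hH i : b * H i <= log_sum_exp b.
  by rewrite -ler_expR lnK ?posrE ?sum_expR_gt0// (bigD1 i)//= lerDl sumr_ge0.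
have -> : c / b * log_sum_exp b = log_sum_exp b + (c - b) / b * log_sum_exp b.
  by field; rewrite gt_eqF.
rewrite expRD lnK ?posrE ?sum_expR_gt0// mulr_suml; apply: ler_sum => i _.
rewrite -expRD ler_expR.
have k0 : 0 <= (c - b) / b by rewrite divr_ge0 ?subr_ge0// ltW.
have := ler_wpM2l k0 (hH i).
have -> : (c - b) / b * (b * H i) = (c - b) * H i by field; rewrite gt_eqF.
by lra.
Qed.

End log_sum_exp.

Section partition_function.
Context {R : realType}.

Lemma sum_config_expR (N : nat) (b : R) (x : 'I_N -> R) :
  \sum_(s : config N) expR (b * \sum_i x i * spin s i) =
  expR (N%:R * ln 2 + \sum_i ln (cosh (b * x i))).
Proof.
transitivity (\prod_(i < N) \sum_(e : bool) expR (b * (x i * (-1) ^+ e))).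
  rewrite bigA_distr_bigA/=; apply: eq_bigr => s _.
  by rewrite mulr_sumr expR_sum.
have -> : N%:R * ln 2 = \sum_(i < N) (ln 2 : R).
  by rewrite sumr_const card_ord mulr_natl.
rewrite -big_split expR_sum; apply: eq_bigr => i _ /=.
rewrite big_bool/= expr1 expr0 expRD !lnK ?posrE ?cosh_gt0//.
rewrite /cosh [RHS]mulrC divfK// mulr1 mulrN1 mulrN; exact: addrC.
Qed.

End partition_function.

Section interpolation.
Context {R : realType}.

(** Between k^2 and (k+1)^2 the sums are monotone and the denominators differ
    by a factor tending to 1, so convergence along the squares suffices. *)
Lemma cvg_average_of_squares (S : nat -> R) (mu : R) :
  {homo S : m n / (m <= n)%N >-> m <= n} -> (forall n, 0 <= S n) ->
  (S (k ^ 2)%N / (k ^ 2)%N%:R @[k --> \oo] --> mu) ->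
  S n / n%:R @[n --> \oo] --> mu.
Proof.
move=> homoS S0 cvgS.
pose k (n : nat) := Nat.sqrt n.
have kle n : (k n ^ 2 <= n)%N.
  have [/ssrnat.leP + _] := PeanoNat.Nat.sqrt_specif n.
  by rewrite expnS expn1.
have klt n : (n < (k n).+1 ^ 2)%N.
  have [_ /ssrnat.ltP] := PeanoNat.Nat.sqrt_specif n.
  by rewrite expnS expn1.
have cvgk : k n @[n --> \oo] --> \oo.
  move=> A [m _ mA]; exists (m ^ 2)%N => //= n mn; apply: mA => /=.
  rewrite leqNgt; apply/negP => knm; have := leq_ltn_trans mn (klt n).
  by rewrite ltnNge leq_exp2r// knm.
pose A j := S (j ^ 2)%N / (j ^ 2)%N%:R.
have cvgA1 : A j.+1 @[j --> \oo] --> mu by rewrite (cvg_shiftS A).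
pose r (j : nat) : R := 1 + (j%:R)^-1.
pose r' (j : nat) : R := 1 - (j.+1%:R)^-1.
have cr : r j @[j --> \oo] --> (1 : R).
  rewrite -[X in _ --> X]addr0; apply: cvgD; first exact: cvg_cst.
  rewrite -(cvg_shiftS (fun n => (n%:R)^-1 : R)); exact: cvg_harmonic.
have cr' : r' j @[j --> \oo] --> (1 : R).
  rewrite -[X in _ --> X]subr0; apply: cvgB; first exact: cvg_cst.
  exact: cvg_harmonic.
have lo : (A (k n) * (r' (k n) * r' (k n)))@[n --> \oo] --> mu.
  have e : A j * (r' j * r' j) @[j --> \oo] --> mu.
    rewrite -[X in _ --> X]mulr1 -[X in mu * X]mulr1.
    by apply: cvgM => //; exact: cvgM.
  exact: (cvg_comp _ _ cvgk e).
have up : (A (k n).+1 * (r (k n) * r (k n)))@[n --> \oo] --> mu.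
  have e : A j.+1 * (r j * r j) @[j --> \oo] --> mu.
    rewrite -[X in _ --> X]mulr1 -[X in mu * X]mulr1.
    by apply: cvgM => //; exact: cvgM.
  exact: (cvg_comp _ _ cvgk e).
apply: squeeze_cvgr lo up.
have : \forall n \near \oo, (0 < k n)%N.
  exact: (cvgk _ (nbhs_infty_gt 0%N)).
apply: filterS => n k0.
have n0 : (0 < n)%N by apply: leq_trans (kle n); rewrite expn_gt0 k0.
have K0 : 0 < (k n)%:R :> R by rewrite ltr0n.
have K1 : 0 < (k n).+1%:R :> R by rewrite ltr0n.
have N0 : 0 < n%:R :> R by rewrite ltr0n.
apply/andP; split.
- have -> : A (k n) * (r' (k n) * r' (k n)) = S (k n ^ 2)%N / ((k n).+1 ^ 2)%N%:R.
    rewrite /A /r' !natrX -natr1; field.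
    by rewrite natr1 !gt_eqF.
  apply: (@le_trans _ _ (S n / ((k n).+1 ^ 2)%N%:R)).
    by rewrite ler_wpM2r ?invr_ge0// homoS.
  by rewrite ler_wpM2l// lef_pV2 ?posrE ?ltr0n ?expn_gt0// ler_nat ltnW.
- have -> : A (k n).+1 * (r (k n) * r (k n)) = S ((k n).+1 ^ 2)%N / (k n ^ 2)%N%:R.
    rewrite /A /r !natrX -natr1; field.
    by rewrite natr1 !gt_eqF.
  apply: (@le_trans _ _ (S n / (k n ^ 2)%N%:R)).
    by rewrite ler_wpM2l// lef_pV2 ?posrE ?ltr0n ?expn_gt0 ?k0// ler_nat.
  by rewrite ler_wpM2r ?invr_ge0// homoS// ltnW.
Qed.

End interpolation.

(** * Independence, second moments and almost sure events *)

Section independence.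
Context {d : measure_display} {T : measurableType d} {R : realType}.
Variable P : probability T R.

Definition independent_functions (f g : T -> R) :=
  forall A B, measurable A -> measurable B ->
    P (f @^-1` A `&` g @^-1` B) = (P (f @^-1` A) * P (g @^-1` B))%E.

Local Notation integ f := (P.-integrable setT (EFin \o f)).

Lemma integrable_measurable (f : T -> R) : integ f -> measurable_fun setT f.
Proof. by move=> /(measurable_int P) /measurable_EFinP. Qed.

Lemma integrable_bounded (f : T -> R) (M : R) :
  measurable_fun setT f -> (forall w, `|f w| <= M) -> integ f.
Proof.
move=> mf fM; apply: measurable_bounded_integrable => //.
  by rewrite (le_lt_trans (probability_le1 _ _))// ltry.
exists M; split; first exact: num_real.
by move=> x Mx w _ /=; rewrite (le_trans (fM w))// ltW.
Qed.

Lemma integrable_le (f g : T -> R) : measurable_fun setT f -> integ g ->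
  (forall w, `|f w| <= g w) -> integ f.
Proof.
move=> mf ig fg; apply: le_integrable ig => //; first exact/measurable_EFinP.
by move=> w _ /=; rewrite lee_fin (le_trans (fg w))// ler_norm.
Qed.

Lemma EFin_Rintegral (f : T -> R) : integ f ->
  (\int[P]_w f w)%:E = (\int[P]_w (f w)%:E)%E.
Proof. by move=> fi; rewrite /Rintegral fineK// integrable_fin_num. Qed.

Lemma integrable_sumR (I : Type) (s : seq I) (f : I -> T -> R) :
  (forall i, integ (f i)) -> integ (fun w => \sum_(i <- s) f i w).
Proof.
move=> fi; rewrite [X in integrable _ _ X](_ : _ =
    (fun w => \sum_(i <- s) (f i w)%:E)%E); last first.
  by apply/funext => w /=; rewrite sumEFin.
by apply: integrable_sum => // i _; exact: fi.
Qed.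

Lemma Rintegral_sum (I : Type) (s : seq I) (f : I -> T -> R) :
  (forall i, integ (f i)) ->
  \int[P]_w (\sum_(i <- s) f i w) = \sum_(i <- s) \int[P]_w f i w.
Proof.
move=> fi; elim: s => [|i s ih].
  by rewrite big_nil -[RHS](Rintegral_set0 P (cst 0)) /Rintegral; congr fine;
    rewrite integral_set0; under eq_integral do rewrite big_nil; rewrite integral0.
rewrite big_cons -ih -RintegralD//; last exact: integrable_sumR.
by apply: eq_Rintegral => w _; rewrite big_cons.
Qed.

Lemma Rintegral_prob_cst (r : R) : \int[P]_w (cst r w) = r.
Proof. by rewrite Rintegral_cst// -[X in fine X]/(P setT) probability_setT mulr1. Qed.

(** The joint law of f and g agrees with the product of the two laws on
    rectangles, hence everywhere, and Fubini's theorem applies to the product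
    of the coordinates. *)
Lemma independent_integral (f g : T -> R) : integ f -> integ g ->
  independent_functions f g ->
  integ (fun w => f w * g w) /\
  \int[P]_w (f w * g w) = (\int[P]_w f w) * (\int[P]_w g w).
Proof.
move=> fi gi fg.
have mf := integrable_measurable fi; have mg := integrable_measurable gi.
have mfg : measurable_fun setT (fun w => (f w, g w)) by exact/measurable_fun_pairP.
pose F : {mfun T >-> R} := mfun_Sub (mem_set mf).
pose G : {mfun T >-> R} := mfun_Sub (mem_set mg).
pose J : {mfun T >-> (R * R)%type} := mfun_Sub (mem_set mfg).
pose p (z : R * R) : \bar R := (z.1 * z.2)%:E.
have mp : measurable_fun setT p.
  by apply/measurable_EFinP/measurable_funM; [exact: measurable_fst|exact: measurable_snd].
have joint (q : R * R -> \bar R) :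
    (\int[distribution P F \x distribution P G]_z q z =
     \int[distribution P J]_z q z)%E.
  apply: eq_measure_integral => A mA _; exact: product_measure_unique.
have mabs : measurable_fun setT (EFin \o (fun y : R => `|y|)).
  by apply/measurable_EFinP; exact: measurableT_comp.
have absE (h : T -> R) (mh : measurable_fun setT h) :
   (\int[distribution P (mfun_Sub (mem_set mh) : {mfun T >-> R})]_y (`|y|)%:E
     = \int[P]_w (`|h w|)%:E)%E.
  by rewrite ge0_integral_distribution.
have abs_fin (h : T -> R) : integ h -> (\int[P]_w (`|h w|)%:E < +oo)%E.
  by move=> /integrableP[_].
have ip : (distribution P F \x distribution P G)%E.-integrable setT p.
  apply/integrable12ltyP => //.
  rewrite (eq_integral (fun x : R => (`|x|)%:E * \int[P]_w (`|g w|)%:E)%E); last first.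
    move=> x _ /=; rewrite -absE -ge0_integralZl//=.
    by apply: eq_integral => y _; rewrite /p /= normrM EFinM.
  rewrite ge0_integralZr//; last by apply: integral_ge0.
  rewrite absE lte_mul_pinfty//; first exact: integral_ge0.
  - by rewrite ge0_fin_numE ?abs_fin//; exact: integral_ge0.
  - exact: abs_fin.
have ifg : P.-integrable setT (p \o J).
  apply/integrableP; split; first exact: measurableT_comp.
  have /integrableP[_] := ip; rewrite joint ge0_integral_distribution//.
  exact: measurableT_comp.
split; first exact: ifg.
rewrite /Rintegral -fineM ?integrable_fin_num//; congr fine.
transitivity (\int[distribution P J]_z p z)%E.
  by rewrite integral_distribution.
rewrite -joint -integral12_prod_meas1// /fubini_F /=.
have Gi : (distribution P G).-integrable setT EFin.
  exact: (integrable_pushforward (phi := g)).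
have Fi : (distribution P F).-integrable setT EFin.
  exact: (integrable_pushforward (phi := f)).
have gE : (\int[distribution P G]_y y%:E = \int[P]_w (g w)%:E)%E.
  by rewrite integral_distribution.
have fE : (\int[distribution P F]_y y%:E = \int[P]_w (f w)%:E)%E.
  by rewrite integral_distribution.
under eq_integral => x _.
  rewrite [X in integral _ _ X](_ : _ = (fun y : R => x%:E * y%:E)%E)//.
  rewrite integralZl// gE.
  over.
rewrite -(EFin_Rintegral gi) integralZr//= fE//.
Qed.

Lemma independent_functions_comp (f g : T -> R) (a b : R -> R) :
  measurable_fun setT a -> measurable_fun setT b ->
  independent_functions f g -> independent_functions (a \o f) (b \o g).
Proof.
move=> ma mb fg A B mA mB.
have mA' : measurable (a @^-1` A) by rewrite -[X in measurable X]setTI; exact: ma.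
have mB' : measurable (b @^-1` B) by rewrite -[X in measurable X]setTI; exact: mb.
exact: (fg _ _ mA' mB').
Qed.

Lemma markov_Rintegral (f : T -> R) (c : R) : 0 < c -> integ f ->
  (forall w, 0 <= f w) ->
  (P [set w | (c <= f w)%R] <= (c^-1 * \int[P]_w f w)%:E)%E.
Proof.
move=> c0 fi f0; have mf := integrable_measurable fi.
rewrite EFinM EFin_Rintegral// lee_pdivlMl//.
pose F : {RV P >-> R} := mfun_Sub (mem_set mf).
have e0 : {in Num.nneg &, {homo (fun x : R => x) : x y / x <= y}} by [].
have mid : measurable_fun setT (fun x : R => x) by exact: measurable_id.
have := @markov _ _ _ P F (fun x => x) c c0 mid (fun r h => h) e0.
rewrite unlock /=.
rewrite [X in P X](_ : _ = [set w | (c <= f w)%R]); last first.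
  by apply/funext => w /=; rewrite lee_fin ger0_norm.
move=> /le_trans; apply; rewrite le_eqVlt; apply/orP; left; apply/eqP.
by apply: eq_integral => w _ /=; rewrite ger0_norm.
Qed.

(** Orthogonality in pairs, which independence in pairs provides, removes the
    cross terms of the square. *)
Lemma second_moment_sum (I : finType) (Z : I -> T -> R) :
  (forall i, integ (fun w => Z i w ^+ 2)) ->
  (forall i j, i != j -> integ (fun w => Z i w * Z j w)) ->
  (forall i j, i != j -> \int[P]_w (Z i w * Z j w) = 0) ->
  integ (fun w => (\sum_i Z i w) ^+ 2) /\
  \int[P]_w ((\sum_i Z i w) ^+ 2) = \sum_i \int[P]_w (Z i w ^+ 2).
Proof.
move=> i2 iij e0.
have iZ i j : integ (fun w => Z i w * Z j w).
  by have [<-|/iij//] := eqVneq i j; exact: i2.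
have e : (fun w => (\sum_i Z i w) ^+ 2) = (fun w => \sum_i \sum_j Z i w * Z j w).
  apply/funext => w; rewrite expr2 mulr_suml; apply: eq_bigr => i _.
  by rewrite mulr_sumr.
rewrite e; split.
  by apply: integrable_sumR => i; exact: integrable_sumR.
rewrite Rintegral_sum; last by move=> i; exact: integrable_sumR.
apply: eq_bigr => i _; rewrite Rintegral_sum//.
rewrite (bigD1 i)//= big1 ?addr0//.
by move=> j ji; rewrite e0// eq_sym.
Qed.

(** The Borel-Cantelli lemma, in the form used for every almost sure bound. *)
Lemma ae_eventually_not (A : nat -> set T) (u : nat -> R) :
  (forall n, measurable (A n)) -> (forall n, 0 <= u n) ->
  (forall n, P (A n) <= (u n)%:E)%E -> cvgn (series u) ->
  {ae P, forall w, \forall n \near \oo, ~ A n w}.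
Proof.
move=> mA u0 Au cu.
have s : (\sum_(n <oo) P (A n) < +oo)%E.
  apply: (@le_lt_trans _ _ (\sum_(n <oo) (u n)%:E)%E).
    by apply: lee_nneseries => // n _; exact: Au.
  have : (\sum_(0 <= n < k) (u n)%:E)%E @[k --> \oo] --> (limn (series u))%:E.
    rewrite [X in X @ _ --> _](_ : _ = EFin \o series u); last first.
      by apply/funext => k; rewrite /= sumEFin.
    exact: cvg_comp cu _.
  by move=> /cvg_lim -> //; exact: ltry.
exists (lim_sup_set A); split.
- by apply: bigcap_measurable => // k _; apply: bigcup_measurable.
- exact: lim_sup_set_cvg0.
- move=> w /= nw n _; apply: contrapT => nA; apply: nw.
  exists n => // m /= nm Am; apply: nA; exists m => //.
Qed.

End independence.

(** * Gaussian exponential moments and generated sigma-algebras *)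

Section gaussian.
Context {R : realType}.
Local Notation mu := (@lebesgue_measure R).

(** The Gaussian density is a version of the Radon-Nikodym derivative. *)
Lemma ge0_integral_normal_prob (m s : R) (f : R -> \bar R) :
  measurable_fun setT f -> (forall x, (0 <= f x)%E) ->
  (\int[normal_prob m s]_x f x = \int[mu]_x (f x * (normal_pdf m s x)%:E))%E.
Proof.
move=> mf f0; have dom := normal_prob_dominates m s.
rewrite -(Radon_Nikodym_SigmaFinite.change_of_variables dom)//.
have ri := Radon_Nikodym_SigmaFinite.f_integrable dom.
have mpdf : measurable_fun setT (fun x => (normal_pdf m s x)%:E).
  by apply/measurable_EFinP; exact: measurable_normal_pdf.
apply: ae_eq_integral => //.
- by apply: emeasurable_funM => //; exact: measurable_int ri.
- exact: emeasurable_funM.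
- apply: ae_eqe_mul2l; apply: integral_ae_eq => // A _ mA.
  by rewrite -Radon_Nikodym_SigmaFinite.f_integral.
Qed.

(** Completing the square: exponential tilting translates the Gaussian law. *)
Lemma expR_mul_normal_pdf (t s x : R) : s != 0 ->
  expR (t * x) * normal_pdf 0 s x =
  expR (t ^+ 2 * s ^+ 2 / 2) * normal_pdf (t * s ^+ 2) s x.
Proof.
move=> s0; rewrite /normal_pdf (negbTE s0) /normal_fun.
rewrite mulrCA [RHS]mulrCA -!expRD; congr (_ * expR _).
by field.
Qed.

Lemma integral_expR_normal (t s : R) : s != 0 ->
  (\int[normal_prob 0 s]_x (expR (t * x))%:E = (expR (t ^+ 2 * s ^+ 2 / 2))%:E)%E.
Proof.
move=> s0; rewrite ge0_integral_normal_prob//; last first.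
  by apply/measurable_EFinP; exact: measurableT_comp.
under eq_integral => x _ do rewrite -EFinM expR_mul_normal_pdf// EFinM.
rewrite ge0_integralZl//.
- by rewrite integral_normal_pdf mule1.
- by apply/measurable_EFinP; exact: measurable_normal_pdf.
- by move=> x _; rewrite lee_fin normal_pdf_ge0.
Qed.

Context {d : measure_display} {T : measurableType d}.
Variable P : probability T R.

Lemma gaussian_moment_generating (v t : R) (X : {RV P >-> R}) : 0 < v ->
  centered_gaussian v X ->
  P.-integrable setT (EFin \o (fun w => expR (t * X w))) /\
  \int[P]_w expR (t * X w) = expR (t ^+ 2 * v / 2).
Proof.
move=> v0 gX; have sv : Num.sqrt v != 0 by rewrite gt_eqF// sqrtr_gt0.
have me : measurable_fun setT (fun x : R => (expR (t * x))%:E).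
  by apply/measurable_EFinP; exact: measurableT_comp.
(* Lebesgue measure lives on [measurableTypeR R], which has the sigma-algebra
   of [R] but another display, so the law of X is taken there. *)
have mX : @measurable_fun _ _ T (measurableTypeR R) setT X.
  exact: (@measurable_funPT _ _ _ _ X).
pose Y : {mfun T >-> measurableTypeR R} := 
  @mfun_Sub _ _ T (measurableTypeR R) _ (mem_set mX).
have e : (\int[P]_w (expR (t * X w))%:E = (expR (t ^+ 2 * v / 2))%:E)%E.
  transitivity (\int[distribution P Y]_x (expR (t * x))%:E)%E.
    by rewrite ge0_integral_distribution.
  transitivity (\int[normal_prob 0 (Num.sqrt v)]_x (expR (t * x))%:E)%E.
    by apply: eq_measure_integral => A mA _; exact: gX.
  by rewrite integral_expR_normal// sqr_sqrtr// ltW.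
split; last by rewrite /Rintegral e.
apply/integrableP; split; first exact: (measurableT_comp me (measurable_funPT X)).
under eq_integral => x _ do rewrite /= ger0_norm ?expR_ge0//.
by rewrite e ltry.
Qed.

End gaussian.

Section families_theory.
Context {d : measure_display} {T : measurableType d} {R : realType}.
Variable P : probability T R.

(** The generator whose sigma-algebra is [sigma_of X]; naming it lets
    measurability with respect to a family be stated, and proved, with the
    general theory of measurable functions. *)
Definition family_generator (I : choiceType) (X : I -> {RV P >-> R}) : set (set T) :=
  \bigcup_i preimage_set_system setT (X i) measurable.

Local Notation "X .-measurable_function" :=
  (@measurable_fun _ _ (g_sigma_algebraType (family_generator X)) R setT)
  (at level 2, format "X .-measurable_function").

Lemma family_member_measurable (I : choiceType) (X : I -> {RV P >-> R}) (i : I) :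
  X.-measurable_function (X i).
Proof.
move=> _ B mB; apply: sub_sigma_algebra; exists i => //; exists B => //.
Qed.

Lemma family_function_measurable (I : choiceType) (X : I -> {RV P >-> R})
    (f : T -> R) :
  X.-measurable_function f -> measurable_fun setT f.
Proof.
move=> mf _ B mB.
have := mf measurableT B mB.
apply: smallest_sub; first exact: sigma_algebra_measurable.
move=> A [i _ [C mC <-]]; exact: measurable_funP.
Qed.

Lemma independent_families_functions (I J : choiceType)
    (X : I -> {RV P >-> R}) (Y : J -> {RV P >-> R}) (f g : T -> R) :
  independent_families X Y ->
  X.-measurable_function f -> Y.-measurable_function g ->
  independent_functions P f g.
Proof.
move=> XY mf mg A B mA mB.
have := mf measurableT A mA; rewrite setTI => fA.
have := mg measurableT B mB; rewrite setTI => gB.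
exact: XY.
Qed.

Lemma mutually_independent_pair (I : choiceType) (X : I -> {RV P >-> R})
    (i j : I) :
  mutually_independent X -> i != j -> independent_functions P (X i) (X j).
Proof.
move=> mX ij A B mA mB.
pose C k : set R := if k == i then A else B.
have mC k : measurable (C k) by rewrite /C; case: ifP.
have := mX [fset i; j]%fset C mC.
rewrite big_fsetU1/= ?inE// big_seq_fset1 /C eqxx eq_sym (negbTE ij) => <-.
congr (P _); apply/seteqP; split => w /=.
- move=> [Aw Bw] k /=; rewrite !inE => /orP[|] /eqP ->; first by rewrite eqxx.
  by rewrite eq_sym (negbTE ij).
- move=> h; split.
    by have := h i; rewrite /= !inE eqxx => /(_ isT).
  have := h j; rewrite /= !inE eqxx orbT eq_sym (negbTE ij) => /(_ isT) //.
Qed.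

Lemma identically_distributed_integral (I : choiceType) (X : I -> {RV P >-> R})
    (a : R -> R) (i j : I) :
  identically_distributed X -> measurable_fun setT a ->
  P.-integrable setT (EFin \o (a \o X i)) ->
  P.-integrable setT (EFin \o (a \o X j)) /\
  \int[P]_w a (X i w) = \int[P]_w a (X j w).
Proof.
move=> dX ma ii.
have meq A : measurable A -> A `<=` setT -> distribution P (X i) A = distribution P (X j) A.
  by move=> mA _; exact: dX.
have mae : measurable_fun setT (EFin \o a) by exact/measurable_EFinP.
have ij : P.-integrable setT (EFin \o (a \o X j)).
  apply/integrableP; split.
    by apply/measurable_EFinP; exact: measurableT_comp.
  have /integrableP[_] := ii.
  rewrite -[X in (X < _)%E -> _](ge0_integral_distribution (X i)
    (f := fun x => `|(a x)%:E|%E))//; last first.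
    exact: measurableT_comp.
  rewrite [X in (X < _)%E -> _](_ : _ = \int[distribution P (X j)]_x `|(a x)%:E|)%E; last first.
    exact: eq_measure_integral.
  by rewrite ge0_integral_distribution//; exact: measurableT_comp.
split=> //; congr fine.
rewrite -[LHS](integral_distribution (X := X i) (f := EFin \o a))//.
rewrite -[RHS](integral_distribution (X := X j) (f := EFin \o a))//.
exact: eq_measure_integral.
Qed.

End families_theory.

Notation "X .-measurable_function" :=
  (@measurable_fun _ _ (g_sigma_algebraType (family_generator X)) _ setT)
  (at level 2, format "X .-measurable_function").

(** * The annealed pressure and the critical inverse temperature *)

Section hyperbolic_measurable.
Context {d : measure_display} {T : measurableType d} {R : realType}.

Lemma measurable_log_cosh_mul (b : R) (f : T -> R) : measurable_fun setT f ->
  measurable_fun setT (fun w => ln (cosh (b * f w))).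
Proof.
move=> mf.
have mc : measurable_fun setT (fun u : R => ln (cosh u)).
  by apply: continuous_measurable_fun; exact: continuous_log_cosh.
exact: (measurableT_comp mc (measurable_funM (measurable_cst b) mf)).
Qed.

Lemma measurable_tanh_mul (b : R) (f : T -> R) : measurable_fun setT f ->
  measurable_fun setT (fun w => f w * tanh (b * f w)).
Proof.
move=> mf; apply: measurable_funM => //.
have mc : measurable_fun setT (@tanh R).
  by apply: continuous_measurable_fun; exact: continuous_tanh.
exact: (measurableT_comp mc (measurable_funM (measurable_cst b) mf)).
Qed.

Lemma measurable_expR_mul (b : R) (f : T -> R) : measurable_fun setT f ->
  measurable_fun setT (fun w => expR (b * f w)).
Proof.
move=> mf.
exact: (measurableT_comp (@measurable_expR R) (measurable_funM (measurable_cst b) mf)).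
Qed.

End hyperbolic_measurable.

Section mean_functions.
Context {d : measure_display} {T : measurableType d} {R : realType}.
Variable P : probability T R.
Variable g : {RV P >-> R}.
Hypothesis g_exp : forall t : R, ('E_P[fun w => expR (t * g w)%R] < +oo)%E.

Local Notation integ f := (P.-integrable setT (EFin \o f)).

Lemma integrable_expR_mul (t : R) : integ (fun w => expR (t * g w)).
Proof.
apply/integrableP; split.
  by apply/measurable_EFinP; exact: measurable_expR_mul.
under eq_integral => w _ do rewrite /= ger0_norm ?expR_ge0//.
by have := g_exp t; rewrite unlock.
Qed.

Lemma integrable_cosh_bound : integ (fun w => 2 * (expR (1 * g w) + expR (-1 * g w))).
Proof.
have i := integrableD measurableT (integrable_expR_mul 1) (integrable_expR_mul (-1)).
exact: (integrableZl measurableT 2 i).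
Qed.

Lemma integrable_sqr : integ (fun w => g w ^+ 2).
Proof.
apply: integrable_le integrable_cosh_bound _.
  exact: measurable_funX.
move=> w; rewrite ger0_norm ?sqr_ge0// mul1r mulN1r.
have := expR_ge1Dxn 1 (normr_ge0 (g w)); rewrite real_normK ?num_real//.
have : expR `|g w| <= expR (g w) + expR (- g w).
  by have [_|_] := ger0P (g w); rewrite ?lerDl ?lerDr expR_ge0.
by rewrite (_ : 2`! = 2%N)//; lra.
Qed.

Lemma integrable_abs : integ (fun w => `|g w|).
Proof.
apply: integrable_le integrable_cosh_bound _.
  exact: measurableT_comp.
move=> w; rewrite normr_id mul1r mulN1r.
have := expR_ge1Dx `|g w|; have := normr_ge0 (g w).
have : expR `|g w| <= expR (g w) + expR (- g w).
  by have [_|_] := ger0P (g w); rewrite ?lerDl ?lerDr expR_ge0.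
lra.
Qed.

Lemma integrable_scaled_abs (c : R) : integ (fun w => c * `|g w|).
Proof. exact: (integrableZl measurableT c integrable_abs). Qed.

Lemma abs_log_cosh_mul (b x : R) : `|ln (cosh (b * x))| <= `|b| * `|x|.
Proof. by rewrite ger0_norm ?log_cosh_ge0// -normrM log_cosh_le_abs. Qed.

Lemma integrable_log_cosh (b : R) : integ (fun w => ln (cosh (b * g w))).
Proof.
apply: integrable_le (integrable_scaled_abs `|b|) _.
  exact: measurable_log_cosh_mul.
by move=> w; exact: abs_log_cosh_mul.
Qed.

Lemma integrable_sqr_log_cosh (b : R) : integ (fun w => ln (cosh (b * g w)) ^+ 2).
Proof.
have i : integ (fun w => `|b| ^+ 2 * g w ^+ 2).
  exact: (integrableZl measurableT (`|b| ^+ 2) integrable_sqr).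
apply: integrable_le i _.
  by apply: measurable_funX; exact: measurable_log_cosh_mul.
move=> w; rewrite normrX -[g w ^+ 2]real_normK ?num_real// -exprMn.
by rewrite lerXn2r ?nnegrE ?normr_ge0 ?mulr_ge0// abs_log_cosh_mul.
Qed.

Lemma integrable_tanh (b : R) : integ (fun w => g w * tanh (b * g w)).
Proof.
apply: integrable_le integrable_abs _.
  exact: measurable_tanh_mul.
by move=> w; exact: abs_mul_tanh_le.
Qed.

Lemma mean_log_coshE (b : R) :
  mean_log_cosh g b = \int[P]_w ln (cosh (b * g w)).
Proof. by rewrite /mean_log_cosh unlock. Qed.

Lemma mean_tanhE (b : R) :
  mean_tanh g b = \int[P]_w (g w * tanh (b * g w)).
Proof. by rewrite /mean_tanh unlock. Qed.

(** The bound by a multiple of |x|, uniform for b near a, makes a multiple of |g|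
    a dominating function near a. *)
Lemma continuous_mean (f : R -> R -> R) (C : R -> R) :
  (forall b, measurable_fun setT (fun w => f b (g w))) ->
  (forall x, continuous (f ^~ x)) ->
  (forall a b, `|b - a| < 1 -> forall x, `|f b x| <= C a * `|x|) ->
  continuous (fun b => \int[P]_w f b (g w)).
Proof.
move=> mf cf fC a.
have near_a b : `]a - 1, a + 1[%classic b -> `|b - a| < 1.
  by rewrite /= in_itv/= => /andP[h1 h2]; rewrite ltr_norml; apply/andP; split; lra.
have aI : a \in `]a - 1, a + 1[%classic.
  by rewrite inE /= in_itv/=; apply/andP; split; lra.
apply: (@continuity_under_integral _ _ _ P (fun b w => f b (g w)) setT _
  (a - 1) (a + 1) _ _ (fun w => C a * `|g w|)) => //.
- move=> b /near_a ba; apply: integrable_le (integrable_scaled_abs (C a)) _ => //.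
  by move=> w; exact: fC.
- by apply: nearW => w _ b _; exact: cf.
- exact: integrable_scaled_abs.
- by move=> b /near_a ba; apply: nearW => w _; exact: fC.
Qed.

Lemma continuous_mulr_arg (x : R) : continuous (fun b : R => b * x).
Proof. by move=> b; exact: mulrr_continuous. Qed.

Lemma continuous_mean_log_cosh : continuous (mean_log_cosh g).
Proof.
have -> : mean_log_cosh g = fun b => \int[P]_w ln (cosh (b * g w)).
  by apply/funext => b; exact: mean_log_coshE.
apply: (@continuous_mean (fun b x => ln (cosh (b * x))) (fun a => `|a| + 1)).
- by move=> b; exact: measurable_log_cosh_mul.
- move=> x b.
  exact: (continuous_comp (@continuous_mulr_arg x b) (@continuous_log_cosh R _)).
- move=> a b ba x; apply: le_trans (abs_log_cosh_mul b x) _.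
  rewrite ler_wpM2r//; have := ler_normD (b - a) a.
  by rewrite subrK => h; lra.
Qed.

Lemma continuous_mean_tanh : continuous (mean_tanh g).
Proof.
have -> : mean_tanh g = fun b => \int[P]_w (g w * tanh (b * g w)).
  by apply/funext => b; exact: mean_tanhE.
apply: (@continuous_mean (fun b x => x * tanh (b * x)) (fun=> 1)).
- by move=> b; exact: measurable_tanh_mul.
- move=> x b; apply: cvgM; first exact: cvg_cst.
  exact: (continuous_comp (@continuous_mulr_arg x b) (@continuous_tanh R _)).
- by move=> a b _ x; rewrite mul1r abs_mul_tanh_le.
Qed.

Definition annealed_pressure (b : R) : R :=
  ln 2 + b ^+ 2 / 2 + mean_log_cosh g b.

(** The value b phi'(b) - phi(b) + log 2, for phi the annealed pressure. Log 2
    minus this is the entropy left at inverse temperature b. *)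
Definition energy_gap (b : R) : R :=
  b ^+ 2 / 2 + b * mean_tanh g b - mean_log_cosh g b.

Lemma continuous_annealed_pressure : continuous annealed_pressure.
Proof.
move=> b; apply: cvgD; last exact: continuous_mean_log_cosh.
apply: cvgD; first exact: cvg_cst.
by apply: cvgM; [exact: exprn_continuous|exact: cvg_cst].
Qed.

Lemma continuous_energy_gap : continuous energy_gap.
Proof.
move=> b; apply: cvgB; last exact: continuous_mean_log_cosh.
apply: cvgD; last by apply: cvgM; [exact: cvg_id|exact: continuous_mean_tanh].
by apply: cvgM; [exact: exprn_continuous|exact: cvg_cst].
Qed.

Lemma integrable_dual (b : R) :
  integ (fun w => b * (g w * tanh (b * g w)) - ln (cosh (b * g w))).
Proof.
have i := integrableZl measurableT b (integrable_tanh b).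
exact: (integrableB measurableT i (integrable_log_cosh b)).
Qed.

Lemma mean_dualE (b : R) : b * mean_tanh g b - mean_log_cosh g b =
  \int[P]_w (b * (g w * tanh (b * g w)) - ln (cosh (b * g w))).
Proof.
rewrite RintegralB//; last 2 first.
- exact: (integrableZl measurableT b (integrable_tanh b)).
- exact: integrable_log_cosh.
rewrite RintegralZl//; last exact: integrable_tanh.
by rewrite mean_tanhE mean_log_coshE.
Qed.

Lemma mean_dual_homo (b c : R) : 0 <= b -> b <= c ->
  b * mean_tanh g b - mean_log_cosh g b <= c * mean_tanh g c - mean_log_cosh g c.
Proof.
move=> b0 bc; rewrite !mean_dualE; apply: le_Rintegral => //.
- exact: integrable_dual.
- exact: integrable_dual.
- by move=> w _; exact: log_cosh_dual_homo.
Qed.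

Lemma energy_gap_mono (b c : R) : 0 <= b -> b < c -> energy_gap b < energy_gap c.
Proof.
move=> b0 bc; have := mean_dual_homo b0 (ltW bc).
have : b ^+ 2 < c ^+ 2 by rewrite ltr_pXn2r ?nnegrE//; lra.
rewrite /energy_gap; lra.
Qed.

Lemma mean_log_cosh0 : mean_log_cosh g 0 = 0.
Proof.
rewrite mean_log_coshE -[RHS](Rintegral_prob_cst P 0).
by apply: eq_Rintegral => w _; rewrite mul0r cosh0 ln1.
Qed.

(** The square root is 0 on negative arguments, so a solution is nonnegative;
    it is not 0, because at 0 the right-hand side is the square root of 2 log 2. *)
Lemma is_criticalP (b : R) : is_critical g b <-> 0 < b /\ energy_gap b = ln 2.
Proof.
have l2 : 0 < ln (2 : R) by rewrite ln_gt0// ltr1n.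
rewrite /is_critical; set a := 2 * _; split.
- move=> bE.
  have b0 : 0 <= b by rewrite bE sqrtr_ge0.
  have [b00|bn0] := eqVneq b 0.
    have := bE; rewrite /a b00 mul0r mean_log_cosh0 subrr subr0.
    by move/esym/eqP; rewrite gt_eqF// sqrtr_gt0 mulr_gt0.
  have bp : 0 < b by rewrite lt_neqAle eq_sym bn0.
  have a0 : 0 < a by rewrite -sqrtr_gt0 -bE.
  have : b ^+ 2 = a by rewrite {1}bE sqr_sqrtr// ltW.
  by rewrite /a /energy_gap => h; split=> //; rewrite h; lra.
- move=> [b0 gb]; have -> : a = b ^+ 2 by rewrite /a -gb /energy_gap; lra.
  by rewrite sqrtr_sqr gtr0_norm.
Qed.

(** At sqrt (2 log 2) the term b^2/2 alone already reaches log 2, the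
    Legendre part being nonnegative; this gives the interval for the
    intermediate value theorem. *)
Lemma critical_exists_unique : exists! b, is_critical g b.
Proof.
have l2 : 0 < ln (2 : R) by rewrite ln_gt0// ltr1n.
pose u := Num.sqrt (2 * ln 2) : R.
have u0 : 0 <= u by rewrite sqrtr_ge0.
have u2 : u ^+ 2 = 2 * ln 2 by rewrite sqr_sqrtr// mulr_ge0 ?ltW.
have gap0 : energy_gap 0 = 0.
  by rewrite /energy_gap expr0n/= !mul0r mean_log_cosh0; lra.
have gapu : ln 2 <= energy_gap u.
  have := mean_dual_homo (lexx 0) u0; rewrite mean_log_cosh0 /energy_gap u2; lra.
have [b bI bE] : exists2 b, b \in `[0, u] & energy_gap b = ln 2.
  apply: IVT => //; first exact/continuous_subspaceT/continuous_energy_gap.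
  rewrite gap0; apply/andP; split; first by rewrite ge_min ltW.
  by rewrite le_max gapu orbT.
have b0 : 0 < b.
  move: bI; rewrite in_itv/= => /andP[b0 _]; rewrite lt_neqAle b0 andbT.
  by apply/eqP => b00; move: bE; rewrite -b00 gap0 => /eqP; rewrite lt_eqF.
exists b; split; first exact/is_criticalP.
move=> c /is_criticalP[c0 cE]; case: (ltgtP b c) => // h.
- by have := energy_gap_mono (ltW b0) h; rewrite bE cE ltxx.
- by have := energy_gap_mono (ltW c0) h; rewrite bE cE ltxx.
Qed.

(** The integrated tangent inequality for log cosh, with the exact remainder of
    the quadratic term: this remainder makes the later comparisons strict. *)
Lemma annealed_pressure_tangent (b c : R) :
  annealed_pressure b + (c - b) * (b + mean_tanh g b) + (c - b) ^+ 2 / 2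
    <= annealed_pressure c.
Proof.
have : mean_log_cosh g b + (c - b) * mean_tanh g b <= mean_log_cosh g c.
  rewrite !mean_log_coshE mean_tanhE -RintegralZl//; last exact: integrable_tanh.
  have i := integrableZl measurableT (c - b) (integrable_tanh b).
  rewrite -RintegralD//; last exact: integrable_log_cosh.
  apply: le_Rintegral => //.
  - exact: (integrableD measurableT (integrable_log_cosh b) i).
  - exact: integrable_log_cosh.
  - move=> w _; have := log_cosh_tangent (b * g w) (c * g w).
    by rewrite -mulrBl mulrA.
rewrite /annealed_pressure; nra.
Qed.

(** At the critical point the tangent to the annealed pressure, whose slope is
    the maximal energy, passes through the origin. *)
Lemma annealed_pressure_critical (b : R) : energy_gap b = ln 2 ->
  annealed_pressure b = b * max_energy g b.
Proof. by move=> bE; rewrite /annealed_pressure /max_energy -bE /energy_gap; lra. Qed.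

(** Below its point of contact c the annealed pressure lies strictly above the
    tangent at c, which is a ray from the origin. This inequality decides where
    the second moment argument works. *)
Lemma annealed_pressure_ray (b c : R) : 0 < b -> b < c -> energy_gap c = ln 2 ->
  annealed_pressure c < c / b * annealed_pressure b.
Proof.
move=> b0 bc cE; have := annealed_pressure_tangent c b.
rewrite (annealed_pressure_critical cE) -/(max_energy g c) => h.
have c0 : 0 < c := lt_trans b0 bc.
have k : 0 < c / b by rewrite divr_gt0.
have h' : b * max_energy g c < annealed_pressure b.
  apply: lt_le_trans h; have : 0 < (b - c) ^+ 2 by rewrite exprn_even_gt0//= subr_eq0 lt_eqF.
  lra.
have := h'; rewrite -(ltr_pM2l k) mulrA divfK// ?gt_eqF//.
Qed.

End mean_functions.

(** * Strong law of large numbers for the random field *)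

Section summable_series.
Context {R : realType}.

(** Each term is at most 2/(k+1) - 2/(k+2), and these telescope. *)
Lemma is_cvg_series_inv_sqr : cvgn (series (fun k => (k.+1%:R ^- 2 : R))).
Proof.
apply: nondecreasing_is_cvgn.
  by apply: nondecreasing_series => k _ _; rewrite invr_ge0 sqr_ge0.
exists 2 => _ [n _ <-].
suff h : series (fun k => (k.+1%:R ^- 2 : R)) n <= 2 - 2 / n.+1%:R.
  by apply: le_trans h _; rewrite lerBlDr lerDl divr_ge0.
elim: n => [|n ih]; first by rewrite seriesEnat/= big_geq// divr1 subrr.
rewrite seriesSr; apply: le_trans (lerD ih (lexx _)) _.
have n0 : 0 <= n%:R :> R by [].
rewrite -(natr1 n.+1) -(natr1 n); set x := n%:R + 1 : R.
have x1 : 1 <= x by rewrite lerDr.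
rewrite -subr_ge0.
have -> : 2 - 2 / (x + 1) - (2 - 2 / x + x ^- 2) = (x - 1) / (x ^+ 2 * (x + 1)).
  by field; apply/andP; split; rewrite gt_eqF//; lra.
by rewrite divr_ge0 ?subr_ge0// mulr_ge0 ?sqr_ge0//; lra.
Qed.

Lemma is_cvg_series_expR (C c : R) : 0 < c ->
  cvgn (series (fun n => C * expR (- c * n%:R))).
Proof.
move=> c0.
have -> : (fun n => C * expR (- c * n%:R)) = geometric C (expR (- c)).
  by apply/funext => n; rewrite /= mulrC -expRM_natr mulrC.
by apply: is_cvg_geometric_series; rewrite ger0_norm ?expR_ge0// expR_lt1 oppr_lt0.
Qed.

End summable_series.

Section strong_law.
Context {d : measure_display} {T : measurableType d} {R : realType}.
Variable P : probability T R.

Local Notation integ f := (P.-integrable setT (EFin \o f)).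

(** Countably many values of e suffice. *)
Lemma ae_cvg_dist (a : nat -> T -> R) (l : R) :
  (forall e : R, 0 < e ->
     {ae P, forall w, \forall n \near \oo, `|l - a n w| <= e}) ->
  {ae P, forall w, a n w @[n --> \oo] --> l}.
Proof.
move=> h.
have : {ae P, forall w, forall m : nat,
    \forall n \near \oo, `|l - a n w| <= m.+1%:R^-1}.
  by apply: ae_foralln => m; apply: h.
apply: filterS => w hw; apply/cvgrPdist_le => e e0.
have [m me] : exists m : nat, m.+1%:R^-1 <= e.
  have /= := @cvgr0_norm_le _ _ _ _ _ _ (@cvg_harmonic R) e e0.
  move=> [m _ /(_ m (leqnn m))] /=; rewrite ger0_norm// => me.
  by exists m.
by apply: filterS (hw m) => n /le_trans; apply.
Qed.

(** Chebyshev's inequality is summable along the squares, where Borel-Cantelli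
    applies; nonnegativity of the Y i makes the sums monotone and fills the gaps. *)
Lemma strong_law_pairwise (Y : nat -> T -> R) (mu v : R) :
  (forall i w, 0 <= Y i w) ->
  (forall i, integ (Y i)) -> (forall i, integ (fun w => Y i w ^+ 2)) ->
  (forall i j, i != j -> independent_functions P (Y i) (Y j)) ->
  (forall i, \int[P]_w Y i w = mu) ->
  (forall i, \int[P]_w (Y i w ^+ 2) <= v) ->
  {ae P, forall w, (\sum_(i < n) Y i w) / n%:R @[n --> \oo] --> mu}.
Proof.
move=> Y0 iY iY2 indY EY EY2.
have v0 : 0 <= v by apply: le_trans (EY2 0%N); apply: Rintegral_ge0 => w _; exact: sqr_ge0.
pose Z i w := Y i w - mu.
have imu : integ (cst mu) by exact: finite_measure_integrable_cst.
have iZ i : integ (Z i) by exact: (integrableB measurableT (iY i) imu).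
have EZ i : \int[P]_w Z i w = 0.
  by rewrite RintegralB// EY (Rintegral_prob_cst P) subrr.
have ZE i : (fun w => Z i w ^+ 2) = (fun w => Y i w ^+ 2 - ((2 * mu) * Y i w - mu ^+ 2)).
  by apply/funext => w; rewrite /Z; ring.
have i2mu i : integ (fun w => (2 * mu) * Y i w).
  exact: (integrableZl measurableT (2 * mu) (iY i)).
have imu2 : integ (cst (mu ^+ 2)) by exact: finite_measure_integrable_cst.
have iL i : integ (fun w => (2 * mu) * Y i w - mu ^+ 2).
  exact: (integrableB measurableT (i2mu i) imu2).
have iZ2 i : integ (fun w => Z i w ^+ 2).
  by rewrite ZE; exact: (integrableB measurableT (iY2 i) (iL i)).
have EZ2 i : \int[P]_w (Z i w ^+ 2) <= v.
  rewrite ZE RintegralB// RintegralB// RintegralZl// EY (Rintegral_prob_cst P (mu ^+ 2)).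
  have := EY2 i; have := sqr_ge0 mu; lra.
have indZ i j : i != j -> integ (fun w => Z i w * Z j w) /\
    \int[P]_w (Z i w * Z j w) = 0.
  move=> ij.
  have mb : measurable_fun setT (fun y : R => y - mu) by exact: measurable_funB.
  have [iZZ ->] := independent_integral (iZ i) (iZ j)
    (independent_functions_comp mb mb (indY i j ij)).
  by rewrite EZ mul0r.
have sum2 n : integ (fun w => (\sum_(i < n) Z i w) ^+ 2) /\
    \int[P]_w ((\sum_(i < n) Z i w) ^+ 2) <= n%:R * v.
  have [||| -> ->] // := @second_moment_sum _ _ _ P 'I_n (fun i => Z i).
  - by move=> i j ij; have [] := indZ i j ij.
  - by move=> i j ij; have [] := indZ i j ij.
  - split=> //; have -> : n%:R * v = \sum_(i < n) v by rewrite sumr_const card_ord mulr_natl.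
    by apply: ler_sum => i _; exact: EZ2.
have squares : {ae P, forall w,
    (\sum_(i < k.+1 ^ 2) Y i w) / (k.+1 ^ 2)%N%:R @[k --> \oo] --> mu}.
  apply: ae_cvg_dist => e e0.
  (* The squares start at 1, so that no average has denominator 0. *)
  pose A k := [set w | (e * (k.+1 ^ 2)%N%:R) ^+ 2 <= (\sum_(i < k.+1 ^ 2) Z i w) ^+ 2].
  have n0 k : 0 < (k.+1 ^ 2)%N%:R :> R by rewrite ltr0n expn_gt0.
  have c0 k : 0 < (e * (k.+1 ^ 2)%N%:R) ^+ 2 by rewrite exprn_gt0// mulr_gt0.
  have PA k : (P (A k) <= (v / e ^+ 2 * k.+1%:R ^- 2)%:E)%E.
    have [i2 E2] := sum2 (k.+1 ^ 2)%N.
    apply: le_trans (markov_Rintegral (c0 k) i2 _) _; first by move=> w; exact: sqr_ge0.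
    rewrite lee_fin -ler_pdivlMl ?invr_gt0// invrK; apply: le_trans E2 _.
    rewrite le_eqVlt; apply/orP; left; apply/eqP.
    by rewrite !natrX; field; rewrite nat1r pnatr_eq0/= gt_eqF.
  have mA k : measurable (A k).
    rewrite -[A k]setTI; apply: measurable_fun_le => //.
    exact: integrable_measurable (sum2 _).1.
  have cu : cvgn (series (fun k => v / e ^+ 2 * k.+1%:R ^- 2)).
    exact: is_cvg_seriesZ is_cvg_series_inv_sqr.
  have u0 k : 0 <= v / e ^+ 2 * k.+1%:R ^- 2.
    by rewrite mulr_ge0 ?divr_ge0 ?sqr_ge0// invr_ge0 sqr_ge0.
  apply: filterS (ae_eventually_not mA u0 PA cu) => w.
  apply: filterS => k /negP; rewrite -ltNge => h.
  have n0k := n0 k; set n := (k.+1 ^ 2)%N in h n0k *.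
  have ZY : \sum_(i < n) Z i w = \sum_(i < n) Y i w - n%:R * mu.
    by rewrite /Z sumrB sumr_const card_ord mulr_natl.
  have en : 0 <= e * n%:R by rewrite ltW// mulr_gt0.
  have : `|\sum_(i < n) Z i w| < e * n%:R.
    by rewrite -(ltr_pXn2r (n := 2))// ?nnegrE// real_normK// num_real.
  have -> : mu - (\sum_(i < n) Y i w) / n%:R = - (\sum_(i < n) Z i w) / n%:R.
    by rewrite ZY; field; rewrite gt_eqF.
  by rewrite normrM normrN normfV (gtr0_norm n0k) ler_pdivrMr// => /ltW.
apply: filterS squares => w hw.
apply: cvg_average_of_squares.
- move=> m n mn; rewrite -!(big_mkord xpredT (fun i => Y i w)).
  rewrite [leRHS](big_cat_nat (leq0n m) mn)/= lerDl; apply: sumr_ge0 => i _; exact: Y0.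
- by move=> n; apply: sumr_ge0 => i _; exact: Y0.
- by rewrite -(cvg_shiftS (fun k => (\sum_(i < k ^ 2) Y i w) / (k ^ 2)%N%:R)).
Qed.

Variable h : nat -> {RV P >-> R}.
Hypothesis h_iid : iid h.
Hypothesis h_exp : forall t : R, ('E_P[fun w => expR (t * h 0%N w)%R] < +oo)%E.

Lemma strong_law_log_cosh (b : R) :
  {ae P, forall w, (\sum_(i < n) ln (cosh (b * h i w))) / n%:R @[n --> \oo]
     --> mean_log_cosh (h 0%N) b}.
Proof.
have [mh dh] := h_iid.
have ma : measurable_fun setT (fun x : R => ln (cosh (b * x))).
  exact: measurable_log_cosh_mul.
have ma2 : measurable_fun setT (fun x : R => ln (cosh (b * x)) ^+ 2).
  exact: measurable_funX.
have i1 := integrable_log_cosh h_exp b.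
have i2 := integrable_sqr_log_cosh h_exp b.
apply: (@strong_law_pairwise (fun i w => ln (cosh (b * h i w))) _
  (\int[P]_w (ln (cosh (b * h 0%N w)) ^+ 2))).
- by move=> i w; exact: log_cosh_ge0.
- by move=> i; have [] := identically_distributed_integral i dh ma i1.
- by move=> i; have [] := identically_distributed_integral i dh ma2 i2.
- move=> i j ij; apply: (independent_functions_comp ma ma).
  exact: mutually_independent_pair.
- move=> i; rewrite mean_log_coshE.
  by have [_ <-] := identically_distributed_integral i dh ma i1.
- by move=> i; have [_ <-] := identically_distributed_integral i dh ma2 i2.
Qed.

End strong_law.

(** * Gibbs weights of the field and the truncated second moment *)

Section truncation.
Context {R : realType}.

Definition truncate (c x : R) : R := if x <= c then x else 0.

Lemma truncate_ge0 (c x : R) : 0 <= x -> 0 <= truncate c x.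
Proof. by rewrite /truncate; case: ifP. Qed.

Lemma truncate_le (c x : R) : 0 <= x -> truncate c x <= x.
Proof. by rewrite /truncate; case: ifP. Qed.

Lemma truncate_le_level (c x : R) : 0 <= c -> truncate c x <= c.
Proof. by rewrite /truncate; case: ifP. Qed.

Lemma measurable_truncate (c : R) : measurable_fun setT (truncate c).
Proof.
by apply: measurable_fun_if => //; exact: measurable_fun_ler.
Qed.

(** Where the truncation at exp k cuts, l > k and exp l is at most
    exp l (exp (l - k))^r: a moment of order 1 + r pays for what is removed. *)
Lemma truncate_expR_ge (k l r : R) : 0 <= r ->
  expR l - expR ((1 + r) * l - r * k) <= truncate (expR k) (expR l).
Proof.
move=> r0; rewrite /truncate ler_expR; case: (leP l k) => lk.
  by rewrite lerBlDr lerDl expR_ge0.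
rewrite subr_le0 ler_expR -subr_ge0.
have -> : (1 + r) * l - r * k - l = r * (l - k) by ring.
by rewrite mulr_ge0// subr_ge0 ltW.
Qed.

End truncation.

Section random_field.
Context {d : measure_display} {T : measurableType d} {R : realType}.
Variable P : probability T R.
Variable h : nat -> {RV P >-> R}.

Definition field_pressure (b : R) (N : nat) (w : T) : R :=
  N%:R * ln 2 + \sum_(i < N) ln (cosh (b * h i w)).

Definition gibbs_weight (b : R) (N : nat) (s : config N) (w : T) : R :=
  expR (b * field_energy h s w - field_pressure b N w).

Lemma sum_expR_field (b : R) (N : nat) (w : T) :
  \sum_(s : config N) expR (b * field_energy h s w) =
  expR (field_pressure b N w).
Proof. exact: (sum_config_expR b (fun i : 'I_N => h i w)). Qed.

Lemma gibbs_weight_sum (b : R) (N : nat) (w : T) :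
  \sum_(s : config N) gibbs_weight b s w = 1.
Proof.
transitivity (\sum_(s : config N) expR (b * field_energy h s w) *
              expR (- field_pressure b N w)).
  by apply: eq_bigr => s _; rewrite /gibbs_weight expRD.
by rewrite -mulr_suml sum_expR_field -expRD subrr expR0.
Qed.

Lemma gibbs_weight_ge0 (b : R) (N : nat) (s : config N) (w : T) :
  0 <= gibbs_weight b s w.
Proof. exact: expR_ge0. Qed.

Lemma gibbs_weight_le1 (b : R) (N : nat) (s : config N) (w : T) :
  gibbs_weight b s w <= 1.
Proof.
rewrite -(gibbs_weight_sum b N w) (bigD1 s)//= lerDl.
by apply: sumr_ge0 => t _; exact: gibbs_weight_ge0.
Qed.

Lemma gibbs_weight_measurable (b : R) (N : nat) (s : config N) :
  h.-measurable_function (gibbs_weight b s).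
Proof.
have mh i := family_member_measurable (X := h) i.
apply: measurableT_comp; first exact: measurable_expR.
apply: measurable_funB.
  apply: measurable_funM => //; apply: measurable_sum => i.
  exact: measurable_funM.
apply: measurable_funD => //; apply: measurable_sum => i.
exact: measurable_log_cosh_mul.
Qed.

Hypothesis h_iid : iid h.
Hypothesis h_exp : forall t : R, ('E_P[fun w => expR (t * h 0%N w)%R] < +oo)%E.

Lemma field_pressure_cvg (b : R) :
  {ae P, forall w, field_pressure b N w / N%:R @[N --> \oo] -->
     ln 2 + mean_log_cosh (h 0%N) b}.
Proof.
apply: filterS (strong_law_log_cosh h_iid h_exp b) => w hw.
have : ln 2 + (\sum_(i < n) ln (cosh (b * h i w))) / n%:R @[n --> \oo]
    --> ln 2 + mean_log_cosh (h 0%N) b.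
  by apply: cvgD => //; exact: cvg_cst.
apply: cvg_trans; apply: near_eq_cvg.
apply: filterS (nbhs_infty_gt 0%N) => n n0.
by rewrite /field_pressure mulrDl mulrAC divff ?mul1r// pnatr_eq0 -lt0n.
Qed.

End random_field.

Section thermodynamics.
Context {d : measure_display} {T : measurableType d} {R : realType}.
Variable P : probability T R.
Variable X : forall N, config N -> {RV P >-> R}.
Variable h : nat -> {RV P >-> R}.
Hypothesis X_iid : forall N : nat, (0 < N)%N -> iid (X (N := N)).
Hypothesis X_gauss : forall N : nat, (0 < N)%N ->
  forall s : config N, centered_gaussian N%:R (X s).
Hypothesis h_X_indep : forall N : nat, (0 < N)%N ->
  independent_families h (X (N := N)).

Local Notation integ f := (P.-integrable setT (EFin \o f)).

Definition gaussian_density (b : R) (N : nat) (s : config N) (w : T) : R :=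
  expR (b * X s w - N%:R * b ^+ 2 / 2).

(** The partition function divided by its conditional mean given the field. *)
Definition normalized_partition (b : R) (N : nat) (w : T) : R :=
  \sum_(s : config N) gibbs_weight h b s w * gaussian_density b s w.

Lemma normalized_partition_gt0 (b : R) (N : nat) (w : T) :
  0 < normalized_partition b N w.
Proof.
pose s0 : config N := [ffun => true].
rewrite /normalized_partition (bigD1 s0)//= ltr_pwDl ?mulr_gt0 ?expR_gt0//.
by apply: sumr_ge0 => s _; rewrite mulr_ge0 ?expR_ge0.
Qed.

Lemma free_energyE (b : R) (N : nat) (w : T) : (0 < N)%N ->
  free_energy X h b w N =
  field_pressure h b N w / N%:R + b ^+ 2 / 2 + ln (normalized_partition b N w) / N%:R.
Proof.
move=> N0; have n0 : N%:R != 0 :> R by rewrite pnatr_eq0 -lt0n.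
have -> : free_energy X h b w N =
   N%:R^-1 * ln (expR (field_pressure h b N w + N%:R * b ^+ 2 / 2) *
                 normalized_partition b N w).
  congr (_ * ln _); rewrite /normalized_partition mulr_sumr.
  apply: eq_bigr => s _; rewrite /gibbs_weight /gaussian_density -!expRD.
  by congr expR; rewrite /hamiltonian; ring.
rewrite lnM ?posrE ?expR_gt0 ?normalized_partition_gt0// expRK.
by field.
Qed.

Lemma gaussian_density_measurable (b : R) (N : nat) (s : config N) :
  (X (N := N)).-measurable_function (gaussian_density b s).
Proof.
have mX := family_member_measurable (X := X (N := N)) s.
apply: measurableT_comp; first exact: measurable_expR.
apply: measurable_funB => //; exact: measurable_funM.
Qed.

(** The exponential moment of order q of b X - N b^2/2; the case q = 1 is the
    normalization. *)
Lemma gaussian_density_moment (b q : R) (N : nat) (s : config N) : (0 < N)%N ->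
  integ (fun w => expR (q * (b * X s w - N%:R * b ^+ 2 / 2))) /\
  \int[P]_w expR (q * (b * X s w - N%:R * b ^+ 2 / 2)) =
    expR (N%:R * (q * (q - 1) * b ^+ 2 / 2)).
Proof.
move=> N0; have n0 : 0 < N%:R :> R by rewrite ltr0n.
have [i e] := gaussian_moment_generating (q * b) n0 (X_gauss N0 s).
have -> : (fun w => expR (q * (b * X s w - N%:R * b ^+ 2 / 2))) =
   (fun w => expR (- (q * (N%:R * b ^+ 2 / 2))) * expR (q * b * X s w)).
  by apply/funext => w; rewrite -expRD; congr expR; ring.
split; first exact: (integrableZl measurableT (expR _) i).
by rewrite RintegralZl// e -expRD; congr expR; field.
Qed.

Lemma gaussian_density_mean1 (b : R) (N : nat) (s : config N) : (0 < N)%N ->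
  integ (gaussian_density b s) /\ \int[P]_w gaussian_density b s w = 1.
Proof.
move=> N0; have [i e] := gaussian_density_moment b 1 s N0.
have E : (fun w => expR (1 * (b * X s w - N%:R * b ^+ 2 / 2))) = gaussian_density b s.
  by apply/funext => w; rewrite mul1r.
rewrite E in i e; split=> //; rewrite e.
by rewrite subrr mulr0 !mul0r mulr0 expR0.
Qed.

Lemma gibbs_weight_integrable (b : R) (N : nat) (s : config N) :
  integ (gibbs_weight h b s).
Proof.
apply: (@integrable_bounded _ _ _ P _ 1).
  exact: family_function_measurable (gibbs_weight_measurable (h := h) b s).
by move=> w; rewrite ger0_norm ?gibbs_weight_ge0// gibbs_weight_le1.
Qed.

Lemma gibbs_weight_mean_sum (b : R) (N : nat) :
  \sum_(s : config N) \int[P]_w gibbs_weight h b s w = 1.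
Proof.
rewrite -Rintegral_sum; last by move=> s; exact: gibbs_weight_integrable.
rewrite -[RHS](Rintegral_prob_cst P 1).
by apply: eq_Rintegral => w _; rewrite gibbs_weight_sum.
Qed.

(** Independence factors each term into the mean of a Gibbs weight and the
    mean 1 of a Gaussian density, and the Gibbs weights sum to 1. *)
Lemma normalized_partition_mean1 (b : R) (N : nat) : (0 < N)%N ->
  integ (normalized_partition b N) /\ \int[P]_w normalized_partition b N w = 1.
Proof.
move=> N0.
have ind (s : config N) : integ (fun w => gibbs_weight h b s w * gaussian_density b s w) /\
    \int[P]_w (gibbs_weight h b s w * gaussian_density b s w) =
    \int[P]_w gibbs_weight h b s w.
  have [i e] := gaussian_density_mean1 b s N0.
  have [ip ->] := independent_integral (gibbs_weight_integrable b s) i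
    (independent_families_functions (h_X_indep N0) (gibbs_weight_measurable (h := h) b s)
       (gaussian_density_measurable b s)).
  by rewrite e mulr1.
split; first by apply: integrable_sumR => s; exact: (ind s).1.
rewrite Rintegral_sum; last by move=> s; exact: (ind s).1.
by rewrite -(gibbs_weight_mean_sum b N); apply: eq_bigr => s _; exact: (ind s).2.
Qed.

Lemma normalized_partition_upper (b e : R) : 0 < e ->
  {ae P, forall w, \forall N \near \oo,
     ln (normalized_partition b N w) / N%:R <= e}.
Proof.
move=> e0.
(* The hypotheses say nothing for N = 0, where the event is taken empty. *)
pose A N := if (0 < N)%N then
  [set w | expR (e * N%:R) <= normalized_partition b N w] else set0.
have mA N : measurable (A N).
  rewrite /A; case: ifP => // N0; rewrite -[X in measurable X]setTI.
  apply: measurable_fun_le => //.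
  exact: integrable_measurable (normalized_partition_mean1 b N0).1.
have PA N : (P (A N) <= (1 * expR (- e * N%:R))%:E)%E.
  rewrite /A; case: ifP => N0; last by rewrite measure0 lee_fin mul1r expR_ge0.
  have [i E] := normalized_partition_mean1 b N0.
  apply: le_trans (markov_Rintegral (expR_gt0 _) i _) _.
    by move=> w; exact/ltW/normalized_partition_gt0.
  by rewrite E mulr1 mul1r mulNr expRN.
have u0 N : 0 <= 1 * expR (- e * N%:R) by rewrite mul1r expR_ge0.
have := ae_eventually_not mA u0 PA (@is_cvg_series_expR R 1 _ e0).
apply: filterS => w; apply: filterS2 (nbhs_infty_gt 0%N) => N N0.
rewrite /A N0 /= => /negP; rewrite -ltNge => h1.
rewrite ler_pdivrMr ?ltr0n// -ler_expR lnK ?posrE ?normalized_partition_gt0//.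
exact: ltW.
Qed.

Section truncated_second_moment.
Variables (beta q a b : R).
Hypothesis q1 : 1 < q.

Let p (N : nat) (s : config N) (w : T) : R :=
  truncate (expR (- (N%:R * a))) (gibbs_weight h beta s w).
Let xi (N : nat) (s : config N) (w : T) : R :=
  truncate (expR (N%:R * b)) (gaussian_density beta s w).
Let m (N : nat) (s : config N) : R := \int[P]_w xi s w.

Let p_ge0 N (s : config N) w : 0 <= p s w.
Proof. by apply: truncate_ge0; exact: gibbs_weight_ge0. Qed.

Let xi_ge0 N (s : config N) w : 0 <= xi s w.
Proof. by apply: truncate_ge0; exact: expR_ge0. Qed.

Let p_le_weight N (s : config N) w : p s w <= gibbs_weight h beta s w.
Proof. by apply: truncate_le; exact: gibbs_weight_ge0. Qed.

Let xi_le_density N (s : config N) w : xi s w <= gaussian_density beta s w.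
Proof. by apply: truncate_le; exact: expR_ge0. Qed.

Let p_le N (s : config N) w : p s w <= expR (- (N%:R * a)).
Proof. by apply: truncate_le_level; exact: expR_ge0. Qed.

Let xi_le N (s : config N) w : xi s w <= expR (N%:R * b).
Proof. by apply: truncate_le_level; exact: expR_ge0. Qed.

Let mp N (s : config N) : h.-measurable_function (p s).
Proof.
exact: (measurableT_comp (measurable_truncate _) (gibbs_weight_measurable (h := h) beta s)).
Qed.

Let mxi N (s : config N) : (X (N := N)).-measurable_function (xi s).
Proof.
exact: (measurableT_comp (measurable_truncate _) (gaussian_density_measurable beta s)).
Qed.

Let ixi N (s : config N) : integ (xi s).
Proof.
apply: (@integrable_bounded _ _ _ P _ (expR (N%:R * b))).
  exact: family_function_measurable (mxi s).
by move=> w; rewrite ger0_norm.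
Qed.

Let m_ge N (s : config N) : (0 < N)%N ->
  1 - expR (- (N%:R * ((q - 1) * (b - q * beta ^+ 2 / 2)))) <= m s.
Proof.
move=> N0; have [i1 e1] := gaussian_density_mean1 beta s N0.
have [iq eq] := gaussian_density_moment beta q s N0.
(* Truncation error at level N b, bounded through the moment of order q. *)
pose k := expR (- ((q - 1) * (N%:R * b))).
have ik : integ (fun w => k * expR (q * (beta * X s w - N%:R * beta ^+ 2 / 2))).
  exact: (integrableZl measurableT k iq).
have -> : expR (- (N%:R * ((q - 1) * (b - q * beta ^+ 2 / 2)))) =
    \int[P]_w (k * expR (q * (beta * X s w - N%:R * beta ^+ 2 / 2))).
  by rewrite RintegralZl// eq -expRD; congr expR; field.
rewrite -[X in X - _]e1 -RintegralB// /m; apply: le_Rintegral => //.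
  exact: (integrableB measurableT i1 ik).
move=> w _; rewrite -expRD.
have r0 : 0 <= q - 1 by rewrite subr_ge0 ltW.
apply: le_trans (truncate_expR_ge _ _ r0).
rewrite /gaussian_density lerD2l lerN2 ler_expR le_eqVlt; apply/orP; left.
by apply/eqP; ring.
Qed.

Let m_le1 N (s : config N) : (0 < N)%N -> m s <= 1.
Proof.
move=> N0; have [i1 <-] := gaussian_density_mean1 beta s N0.
by rewrite /m; apply: le_Rintegral => // w _; exact: xi_le_density.
Qed.

Let m_ge0 N (s : config N) : 0 <= m s.
Proof. by rewrite /m; apply: Rintegral_ge0 => w _; exact: xi_ge0. Qed.

Let sum_p_ge N w : 1 - expR (field_pressure h (q * beta) N w -
     q * field_pressure h beta N w + N%:R * ((q - 1) * a)) <=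
  \sum_(s : config N) p s w.
Proof.
rewrite -[X in X - _](gibbs_weight_sum h beta N w).
have -> : expR (field_pressure h (q * beta) N w -
     q * field_pressure h beta N w + N%:R * ((q - 1) * a)) =
  \sum_(s : config N) expR (q * (beta * field_energy h s w - field_pressure h beta N w)
     + N%:R * ((q - 1) * a)).
  rewrite -addrA expRD -sum_expR_field mulr_suml; apply: eq_bigr => s _.
  by rewrite -expRD; congr expR; ring.
rewrite -sumrB; apply: ler_sum => s _.
have r0 : 0 <= q - 1 by rewrite subr_ge0 ltW.
apply: le_trans (truncate_expR_ge _ _ r0).
rewrite /gibbs_weight lerD2l lerN2 ler_expR le_eqVlt; apply/orP; left.
by apply/eqP; ring.
Qed.

(** The truncated Gaussian factor is centered by its own mean m, so that two
    fluctuations are orthogonal although the weights p s and p t are dependent. *)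
Let fluctuation N (s : config N) (w : T) : R := p s w * (xi s w - m s).

(** Sorting the factors into field and Gaussian parts is possible because the
    truncations act on them separately. *)
Let fluctuation_pair N (s t : config N) : (0 < N)%N ->
  integ (fun w => fluctuation s w * fluctuation t w) /\
  \int[P]_w (fluctuation s w * fluctuation t w) =
  (\int[P]_w (p s w * p t w)) * (\int[P]_w ((xi s w - m s) * (xi t w - m t))).
Proof.
move=> N0.
have E : (fun w => fluctuation s w * fluctuation t w) =
    (fun w => (p s w * p t w) * ((xi s w - m s) * (xi t w - m t))).
  by apply/funext => w; rewrite /fluctuation; ring.
have mpp : h.-measurable_function (fun w => p s w * p t w) by exact: measurable_funM.
have mxx : (X (N := N)).-measurable_function
    (fun w => (xi s w - m s) * (xi t w - m t)).
  by apply: measurable_funM; exact: measurable_funB.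
rewrite E; apply: independent_integral.
- apply: (@integrable_bounded _ _ _ P _ (expR (- (N%:R * a)) * expR (- (N%:R * a)))).
    exact: family_function_measurable mpp.
  by move=> w; rewrite normrM ler_pM// ger0_norm.
- pose M := expR (N%:R * b) + 1.
  have bd (u : config N) w : `|xi u w - m u| <= M.
    rewrite /M; have := xi_ge0 u w; have := xi_le u w.
    have := m_ge0 u; have := m_le1 u N0.
    by move=> *; rewrite ler_norml; apply/andP; split; lra.
  apply: (@integrable_bounded _ _ _ P _ (M * M)).
    exact: family_function_measurable mxx.
  by move=> w; rewrite normrM ler_pM.
- exact: independent_families_functions (h_X_indep N0) mpp mxx.
Qed.

Let icenter N (s : config N) : integ (fun w => xi s w - m s).
Proof.
have ic : integ (cst (m s)) by exact: finite_measure_integrable_cst.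
exact: (integrableB measurableT (ixi s) ic).
Qed.

Let center_mean0 N (s : config N) : \int[P]_w (xi s w - m s) = 0.
Proof.
rewrite RintegralB//; last exact: finite_measure_integrable_cst.
by rewrite (Rintegral_prob_cst P (m s)) subrr.
Qed.

Let fluctuation_orthogonal N (s t : config N) : (0 < N)%N -> s != t ->
  \int[P]_w (fluctuation s w * fluctuation t w) = 0.
Proof.
move=> N0 st; have [_ ->] := fluctuation_pair s t N0.
pose f (u : config N) (x : R) : R :=
  truncate (expR (N%:R * b)) (expR (beta * x - N%:R * beta ^+ 2 / 2)) - m u.
have mf u : measurable_fun setT (f u).
  apply: measurable_funB => //.
  apply: (measurableT_comp (measurable_truncate _)).
  apply: (measurableT_comp (@measurable_expR R)).
  by apply: measurable_funB => //; exact: measurable_funM.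
have [mX _] := X_iid N0.
have [_ ->] := independent_integral (icenter s) (icenter t)
  (independent_functions_comp (mf s) (mf t) (mutually_independent_pair mX st)).
by rewrite center_mean0 mul0r mulr0.
Qed.

(** One factor of each square is bounded by its truncation level, the other
    keeps its mean; the levels combine into exp (- N (a - b)). *)
Let fluctuation_square N (s : config N) : (0 < N)%N ->
  \int[P]_w (fluctuation s w ^+ 2) <=
  expR (- (N%:R * (a - b))) * \int[P]_w gibbs_weight h beta s w.
Proof.
move=> N0.
have -> : \int[P]_w (fluctuation s w ^+ 2) = \int[P]_w (fluctuation s w * fluctuation s w).
  by apply: eq_Rintegral => w _; rewrite expr2.
have [_ ->] := fluctuation_pair s s N0.
have mp' := family_function_measurable (mp s).
have mxi' := family_function_measurable (mxi s).
have ipp : integ (fun w => p s w * p s w).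
  apply: (@integrable_bounded _ _ _ P _ (expR (- (N%:R * a)) * expR (- (N%:R * a)))).
    exact: measurable_funM.
  by move=> w; rewrite normrM ler_pM// ger0_norm.
have ixx : integ (fun w => xi s w * xi s w).
  apply: (@integrable_bounded _ _ _ P _ (expR (N%:R * b) * expR (N%:R * b))).
    exact: measurable_funM.
  by move=> w; rewrite normrM ler_pM// ger0_norm.
have ig := gibbs_weight_integrable beta s.
have Epp : \int[P]_w (p s w * p s w) <=
    expR (- (N%:R * a)) * \int[P]_w gibbs_weight h beta s w.
  rewrite -RintegralZl//; apply: le_Rintegral => //.
    exact: (integrableZl measurableT _ ig).
  by move=> w _; rewrite ler_pM.
have Exx : \int[P]_w ((xi s w - m s) * (xi s w - m s)) <= expR (N%:R * b).
  have i2 : integ (fun w => (2 * m s) * xi s w).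
    exact: (integrableZl measurableT (2 * m s) (ixi s)).
  have ic : integ (cst (m s ^+ 2)) by exact: finite_measure_integrable_cst.
  have -> : \int[P]_w ((xi s w - m s) * (xi s w - m s)) =
      \int[P]_w (xi s w * xi s w - ((2 * m s) * xi s w - m s ^+ 2)).
    by apply: eq_Rintegral => w _; ring.
  rewrite RintegralB//; last exact: (integrableB measurableT i2 ic).
  rewrite RintegralB// RintegralZl// (Rintegral_prob_cst P (m s ^+ 2)) -/(m s).
  have : \int[P]_w (xi s w * xi s w) <= expR (N%:R * b) * m s.
    rewrite -RintegralZl//; apply: le_Rintegral => //.
      exact: (integrableZl measurableT _ (ixi s)).
    by move=> w _; rewrite ler_pM.
  have := ler_wpM2l (expR_ge0 (N%:R * b)) (m_le1 s N0).
  have := sqr_ge0 (m s); rewrite mulr1; lra.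
have -> : - (N%:R * (a - b)) = - (N%:R * a) + N%:R * b by ring.
rewrite expRD mulrAC; apply: ler_pM => //.
- by apply: Rintegral_ge0 => w _; rewrite mulr_ge0.
- by apply: Rintegral_ge0 => w _; rewrite -expr2 sqr_ge0.
Qed.

Let fluctuation_sum N : (0 < N)%N ->
  integ (fun w => (\sum_(s : config N) fluctuation s w) ^+ 2) /\
  \int[P]_w ((\sum_(s : config N) fluctuation s w) ^+ 2) <=
    expR (- (N%:R * (a - b))).
Proof.
move=> N0.
have [||| i ->] := @second_moment_sum _ _ _ P (config N) (@fluctuation N).
- move=> s; have [i _] := fluctuation_pair s s N0.
  exact: i.
- by move=> s t _; exact: (fluctuation_pair s t N0).1.
- by move=> s t; exact: fluctuation_orthogonal.
split=> //; apply: le_trans (_ : _ <= \sum_(s : config N)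
    expR (- (N%:R * (a - b))) * \int[P]_w gibbs_weight h beta s w) _.
  by apply: ler_sum => s _; exact: fluctuation_square.
by rewrite -mulr_sumr gibbs_weight_mean_sum mulr1.
Qed.

Let fluctuation_small : b < a ->
  {ae P, forall w, \forall N \near \oo,
     - 4^-1 <= \sum_(s : config N) fluctuation s w}.
Proof.
move=> ba; have c0 : 0 < a - b by rewrite subr_gt0.
pose A N := if (0 < N)%N then
  [set w | 16^-1 <= (\sum_(s : config N) fluctuation s w) ^+ 2] else set0.
have mA N : measurable (A N).
  rewrite /A; case: ifP => // N0; rewrite -[X in measurable X]setTI.
  apply: measurable_fun_le => //.
  exact: integrable_measurable (fluctuation_sum N0).1.
have PA N : (P (A N) <= (16 * expR (- (a - b) * N%:R))%:E)%E.
  rewrite /A; case: ifP => N0; last by rewrite measure0 lee_fin mulr_ge0 ?expR_ge0.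
  have [i E] := fluctuation_sum N0.
  have p16 : 0 < 16^-1 :> R by rewrite invr_gt0.
  apply: le_trans (markov_Rintegral p16 i _) _; first by move=> w; exact: sqr_ge0.
  by rewrite invrK lee_fin ler_pM2l// mulNr (mulrC (a - b)).
have u0 N : 0 <= 16 * expR (- (a - b) * N%:R) by rewrite mulr_ge0 ?expR_ge0.
have := ae_eventually_not mA u0 PA (@is_cvg_series_expR R 16 _ c0).
apply: filterS => w; apply: filterS2 (nbhs_infty_gt 0%N) => N N0.
rewrite /A N0 /= => /negP; rewrite -ltNge; set S := \sum_(_ | _) _ => h1.
by rewrite leNgt; apply/negP => h2; move: h1; nra.
Qed.

(** After truncation both the mean m of the Gaussian factor and the total weight
    of the p s are eventually at least 3/4, and the fluctuation is eventually at
    least - 1/4; the product 9/16 leaves room for 1/4. *)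
Lemma truncated_partition_lower (g : R) : b < a -> 0 < g ->
  0 < (q - 1) * (b - q * beta ^+ 2 / 2) ->
  {ae P, forall w,
    (\forall N \near \oo, field_pressure h (q * beta) N w -
       q * field_pressure h beta N w + N%:R * ((q - 1) * a) <= - g * N%:R) ->
    \forall N \near \oo, 4^-1 <= normalized_partition beta N w}.
Proof.
move=> ba g0; set c := (q - 1) * _ => c0.
have small (k : R) : 0 < k -> \forall N \near \oo, expR (- k * N%:R) <= 4^-1.
  move=> k0; have h1 := cvg_series_cvg_0 (@is_cvg_series_expR R 1 _ k0).
  have q0 : 0 < 4^-1 :> R by rewrite invr_gt0.
  have h2 : \forall n \near \oo, `|1 * expR (- k * n%:R)| <= 4^-1.
    exact: (cvgr0_norm_le _ h1).
  by apply: filterS h2 => N; rewrite mul1r ger0_norm ?expR_ge0.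
apply: filterS (fluctuation_small ba) => w hw hfield.
have hc := small c c0; have hg := small g g0.
near=> N.
have N0 : (0 < N)%N by near: N; exact: nbhs_infty_gt.
have h1 : - 4^-1 <= \sum_(s : config N) fluctuation s w by near: N.
have h2 : expR (- c * N%:R) <= 4^-1 by near: N.
have h3 : expR (- g * N%:R) <= 4^-1 by near: N.
have h4 : field_pressure h (q * beta) N w -
       q * field_pressure h beta N w + N%:R * ((q - 1) * a) <= - g * N%:R by near: N.
have hm (s : config N) : 3 / 4 <= m s.
  apply: le_trans (m_ge s N0).
  rewrite -/c (_ : - (N%:R * c) = - c * N%:R); [lra|ring].
have hp : 3 / 4 <= \sum_(s : config N) p s w.
  apply: le_trans (sum_p_ge N w).
  by have := h4; rewrite -ler_expR; lra.
have : \sum_(s : config N) fluctuation s w + 3 / 4 * \sum_(s : config N) p s w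
    <= normalized_partition beta N w.
  rewrite mulr_sumr -big_split; apply: ler_sum => s _ /=.
  apply: (@le_trans _ _ (p s w * xi s w)).
    rewrite /fluctuation; have := ler_wpM2l (p_ge0 s w) (hm s); lra.
  by rewrite ler_pM.
lra.
Unshelve. all: by end_near. Qed.

End truncated_second_moment.

End thermodynamics.

(** * Limit of the free energy *)

Section free_energy_limit.
Context {d : measure_display} {T : measurableType d} {R : realType}.
Variable P : probability T R.
Variable X : forall N, config N -> {RV P >-> R}.
Variable h : nat -> {RV P >-> R}.
Hypothesis X_iid : forall N : nat, (0 < N)%N -> iid (X (N := N)).
Hypothesis X_gauss : forall N : nat, (0 < N)%N ->
  forall s : config N, centered_gaussian N%:R (X s).
Hypothesis h_iid : iid h.
Hypothesis h_X_indep : forall N : nat, (0 < N)%N ->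
  independent_families h (X (N := N)).
Hypothesis h_exp : forall t : R, ('E_P[fun w => expR (t * h 0%N w)%R] < +oo)%E.

Local Notation pressure := (annealed_pressure (h 0%N)).
Local Notation gap := (energy_gap (h 0%N)).
Local Notation Emax := (max_energy (h 0%N)).

Lemma free_energy_log_sum_exp (b : R) (N : nat) (w : T) :
  free_energy X h b w N =
  N%:R^-1 * log_sum_exp (fun s : config N => hamiltonian X h s w) b.
Proof. by []. Qed.

Lemma free_energy_upper (b e : R) : 0 < e ->
  {ae P, forall w, \forall N \near \oo, free_energy X h b w N <= pressure b + e}.
Proof.
move=> e0; have e2 : 0 < e / 2 by rewrite divr_gt0.
apply: filterS2 (field_pressure_cvg h_iid h_exp b)
  (normalized_partition_upper X_gauss h_X_indep b e2) => w cw uw.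
have hw : \forall N \near \oo,
    `|ln 2 + mean_log_cosh (h 0%N) b - field_pressure h b N w / N%:R| <= e / 2.
  by have /cvgrPdist_le := cw; apply.
near=> N.
have N0 : (0 < N)%N by near: N; exact: nbhs_infty_gt.
have h1 : `|ln 2 + mean_log_cosh (h 0%N) b - field_pressure h b N w / N%:R| <= e / 2.
  by near: N.
have h2 : ln (normalized_partition X h b N w) / N%:R <= e / 2 by near: N.
rewrite free_energyE// /annealed_pressure.
by move: h1; rewrite ler_norml => /andP[h3 h4]; lra.
Unshelve. all: by end_near. Qed.

Variable betac : R.
Hypothesis betac_gt0 : 0 < betac.
Hypothesis betac_gap : gap betac = ln 2.

(** With q = betac / b, the excess 3 eta of q phi(b) over phi(betac) is positive.
    It is spent in three equal parts: on the loss of Gibbs weight, on the gap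
    between the truncation levels, and on the loss of Gaussian mass. *)
Lemma free_energy_lower (b e : R) : 0 < b -> b < betac -> 0 < e ->
  {ae P, forall w, \forall N \near \oo, pressure b - e <= free_energy X h b w N}.
Proof.
move=> b0 bc e0; have e2 : 0 < e / 2 by rewrite divr_gt0.
pose q := betac / b.
have q1 : 1 < q by rewrite ltr_pdivlMr// mul1r.
have r0 : 0 < q - 1 by rewrite subr_gt0.
have qb : q * b = betac by rewrite /q divfK// gt_eqF.
pose eta := (q * pressure b - pressure betac) / 3.
have eta0 : 0 < eta.
  by rewrite divr_gt0// subr_gt0; exact: annealed_pressure_ray.
(* The level y for the Gaussian factor exceeds the tilted energy q b^2/2 by one
   share, and the level x for the Gibbs weights exceeds it by two. *)
pose y := q * b ^+ 2 / 2 + eta / (q - 1).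
pose x := q * b ^+ 2 / 2 + 2 * eta / (q - 1).
have rn0 : q - 1 != 0 by rewrite gt_eqF.
have yx : y < x.
  rewrite /y /x ltrD2l ltr_pM2r ?invr_gt0//; lra.
have gapy : 0 < (q - 1) * (y - q * b ^+ 2 / 2).
  by rewrite (_ : _ * _ = eta)//; rewrite /y; field.
have eta2 : 0 < eta / 2 by rewrite divr_gt0.
have := truncated_partition_lower X_iid X_gauss h_X_indep q1 yx eta2 gapy.
apply: filterS3 (field_pressure_cvg h_iid h_exp b)
  (field_pressure_cvg h_iid h_exp betac) => w cb cc lw.
have comb : field_pressure h betac N w / N%:R - q * (field_pressure h b N w / N%:R)
    @[N --> \oo] --> (ln 2 + mean_log_cosh (h 0%N) betac) -
                     q * (ln 2 + mean_log_cosh (h 0%N) b).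
  by apply: cvgB => //; apply: cvgM => //; exact: cvg_cst.
have low : \forall N \near \oo, 4^-1 <= normalized_partition X h b N w.
  apply: lw; rewrite qb.
  have /cvgrPdist_le /(_ _ eta2) := comb.
  apply: filterS2 (nbhs_infty_gt 0%N) => N N0.
  have n0 : 0 < N%:R :> R by rewrite ltr0n.
  rewrite ler_norml => /andP[h1 _].
  have -> : field_pressure h betac N w - q * field_pressure h b N w +
      N%:R * ((q - 1) * x) =
     (field_pressure h betac N w / N%:R - q * (field_pressure h b N w / N%:R)
       + (q - 1) * x) * N%:R.
    by field; rewrite gt_eqF.
  rewrite ler_pM2r//.
  have xE : (q - 1) * x = (q - 1) * q * b ^+ 2 / 2 + 2 * eta.
    by rewrite /x; field.
  have bcE : betac ^+ 2 = q ^+ 2 * b ^+ 2 by rewrite -qb exprMn.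
  have etaE : 3 * eta = q * pressure b - pressure betac by rewrite /eta; field.
  rewrite xE; move: h1 etaE; rewrite /annealed_pressure bcE.
  lra.
have hw : \forall N \near \oo,
    `|ln 2 + mean_log_cosh (h 0%N) b - field_pressure h b N w / N%:R| <= e / 2.
  by have /cvgrPdist_le := cb; apply.
have ln4 : \forall N \near \oo, `|0 - ln (4 : R) * (N%:R)^-1| <= e / 2.
  have c4 : ln (4 : R) * (N%:R)^-1 @[N --> \oo] --> (0 : R).
    rewrite -[X in _ --> X](mulr0 (ln 4)); apply: cvgM; first exact: cvg_cst.
    rewrite -(cvg_shiftS (fun n => (n%:R)^-1 : R)); exact: cvg_harmonic.
  by have /cvgrPdist_le := c4; apply.
near=> N.
have N0 : (0 < N)%N by near: N; exact: nbhs_infty_gt.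
have n0 : 0 < N%:R :> R by rewrite ltr0n.
have h1 : `|ln 2 + mean_log_cosh (h 0%N) b - field_pressure h b N w / N%:R| <= e / 2.
  by near: N.
have h2 : 4^-1 <= normalized_partition X h b N w by near: N.
have h3 : `|0 - ln (4 : R) * (N%:R)^-1| <= e / 2 by near: N.
rewrite free_energyE// /annealed_pressure.
have h4 : - (ln (4 : R) * (N%:R)^-1) <= ln (normalized_partition X h b N w) / N%:R.
  rewrite -mulNr ler_pM2r ?invr_gt0// -lnV ?posrE// ler_ln ?posrE//.
  exact: normalized_partition_gt0.
move: h1 h3; rewrite !ler_norml => /andP[h5 h6] /andP[h7 h8].
lra.
Unshelve. all: by end_near. Qed.

Lemma free_energy_subcritical (b : R) : 0 < b -> b < betac ->
  {ae P, forall w, free_energy X h b w N @[N --> \oo] --> pressure b}.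
Proof.
move=> b0 bc; apply: ae_cvg_dist => e e0.
apply: filterS2 (free_energy_upper b e0) (free_energy_lower b0 bc e0) => w.
apply: filterS2 => N h1 h2.
by rewrite ler_norml; apply/andP; split; lra.
Qed.

Lemma max_energy_gt0 : 0 < Emax betac.
Proof.
rewrite -(pmulr_rgt0 _ betac_gt0) -annealed_pressure_critical// /annealed_pressure.
have : 0 <= mean_log_cosh (h 0%N) betac.
  rewrite mean_log_coshE; apply: Rintegral_ge0 => w _; exact: log_cosh_ge0.
have l2 : 0 < ln (2 : R) by rewrite ln_gt0// ltr1n.
have := sqr_ge0 betac; lra.
Qed.

(** The slope of the chord through b1 < b2 is at least the slope of the tangent
    at b1, so both the chord's height at b2 and its slope approach those of the
    tangent at betac, by continuity of the pressure and of its slope. *)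
Lemma critical_chord (beta e : R) : betac <= beta -> 0 < e ->
  exists b1 b2, [/\ 0 < b1, b1 < b2, b2 < betac &
    Emax betac * beta - e <=
    pressure b2 + (beta - b2) * ((pressure b2 - pressure b1) / (b2 - b1))].
Proof.
move=> cb e0; pose eta := e / (1 + beta).
have beta0 : 0 < beta := lt_le_trans betac_gt0 cb.
have k0 : 0 < 1 + beta by rewrite addr_gt0.
have eta0 : 0 < eta by rewrite divr_gt0.
have cp : \forall x \near betac, `|pressure betac - pressure x| <= eta.
  have /cvgrPdist_le := continuous_annealed_pressure h_exp (x := betac).
  by apply.
have cm : \forall x \near betac, `|Emax betac - Emax x| <= eta.
  have c : {for betac, continuous (fun x => x + mean_tanh (h 0%N) x)}.
    by apply: cvgD; [exact: cvg_id|exact: continuous_mean_tanh].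
  by have /cvgrPdist_le := c; apply.
have c0 : \forall x \near betac, 0 < x by exact: lt_nbhsr.
have : \forall x \near betac, [/\ `|pressure betac - pressure x| <= eta,
   `|Emax betac - Emax x| <= eta & 0 < x].
  near=> x; split; near: x; [exact: cp|exact: cm|exact: c0].
move=> /nbhs_ballP[r /= r0 br].
have near_betac t : 0 < t < 1 -> [/\ `|pressure betac - pressure (betac - t * r)| <= eta,
   `|Emax betac - Emax (betac - t * r)| <= eta & 0 < betac - t * r].
  move=> /andP[t0 t1]; apply: br; rewrite /ball/= opprB addrC subrK.
  by rewrite ger0_norm ?mulr_ge0 ?ltW// gtr_pMl.
have [p2 _ q2] : [/\ `|pressure betac - pressure (betac - 4^-1 * r)| <= eta,
   `|Emax betac - Emax (betac - 4^-1 * r)| <= eta & 0 < betac - 4^-1 * r].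
  by apply: near_betac; apply/andP; split; lra.
have [_ p1 q1] : [/\ `|pressure betac - pressure (betac - 2^-1 * r)| <= eta,
   `|Emax betac - Emax (betac - 2^-1 * r)| <= eta & 0 < betac - 2^-1 * r].
  by apply: near_betac; apply/andP; split; lra.
set b2 := betac - 4^-1 * r in p2 q2; set b1 := betac - 2^-1 * r in p1 q1.
have b12 : b1 < b2 by rewrite /b1 /b2; lra.
have b2c : b2 < betac by rewrite /b2; lra.
exists b1, b2; split=> //.
have slope : Emax b1 <= (pressure b2 - pressure b1) / (b2 - b1).
  rewrite ler_pdivlMr ?subr_gt0//.
  have := annealed_pressure_tangent h_exp b1 b2; rewrite -/(Emax b1).
  have := sqr_ge0 (b2 - b1); lra.
have bb2 : 0 <= beta - b2 by rewrite subr_ge0 (le_trans (ltW b2c)).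
have := ler_wpM2l bb2 slope.
move: p1 p2; rewrite !ler_norml => /andP[_ p1] /andP[_ p2].
have pc := annealed_pressure_critical betac_gap.
have E0 := max_energy_gt0.
have etaE : eta * (1 + beta) = e by rewrite /eta; field; rewrite gt_eqF.
have m1 : (beta - b2) * (Emax betac - eta) <= (beta - b2) * Emax b1.
  by rewrite ler_wpM2l//; lra.
have m2 : 0 <= (betac - b2) * Emax betac by rewrite mulr_ge0 ?subr_ge0// ltW.
have m3 : 0 <= b2 * eta by rewrite mulr_ge0 ?ltW.
move: m1 m2 m3 p2; rewrite pc -etaE; nra.
Unshelve. all: by end_near. Qed.

(** Convexity and monotonicity of (log Z)/beta hold for every realization, so
    they transport the almost sure behavior below and at betac to beta. *)
Lemma free_energy_supercritical (beta : R) : betac <= beta ->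
  {ae P, forall w, free_energy X h beta w N @[N --> \oo] --> Emax betac * beta}.
Proof.
move=> cb; apply: ae_cvg_dist => e e0.
have beta0 : 0 < beta := lt_le_trans betac_gt0 cb.
have k0 : 0 < beta / betac by rewrite divr_gt0.
have e1 : 0 < e / (beta / betac) by rewrite divr_gt0.
have e2 : 0 < e / 2 by rewrite divr_gt0.
(* Half of e for the chord, half for the convergence at its two ends. *)
have [b1 [b2 [b10 b12 b2c hb]]] := critical_chord cb e2.
have b20 : 0 < b2 := lt_trans b10 b12.
have b2beta : b2 <= beta := le_trans (ltW b2c) cb.
have sub1 := free_energy_subcritical b10 (lt_trans b12 b2c).
have sub2 := free_energy_subcritical b20 b2c.
apply: filterS3 (free_energy_upper betac e1) sub1 sub2 => w uw c1 c2.
pose chord (f : R -> R) := f b2 + (beta - b2) * ((f b2 - f b1) / (b2 - b1)).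
have cc : chord (fun b => free_energy X h b w N) @[N --> \oo] --> chord pressure.
  apply: cvgD => //; apply: cvgM; first exact: cvg_cst.
  by apply: cvgM; [exact: cvgB|exact: cvg_cst].
have lc : \forall N \near \oo,
    `|chord pressure - chord (fun b => free_energy X h b w N)| <= e / 2.
  by have /cvgrPdist_le := cc; apply.
near=> N.
have N0 : (0 < N)%N by near: N; exact: nbhs_infty_gt.
have n0 : 0 <= N%:R^-1 :> R by rewrite invr_ge0.
have h1 : `|chord pressure - chord (fun b => free_energy X h b w N)| <= e / 2.
  by near: N.
have h2 : free_energy X h betac w N <= pressure betac + e / (beta / betac) by near: N.
pose s0 : config N := [ffun => true].
have h3 : free_energy X h beta w N <= beta / betac * free_energy X h betac w N.
  rewrite !free_energy_log_sum_exp mulrCA ler_wpM2l//.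
  exact: log_sum_exp_sublinear.
have h4 : chord (fun b => free_energy X h b w N) <= free_energy X h beta w N.
  have := ler_wpM2l n0 (log_sum_exp_chord s0 (fun s : config N => hamiltonian X h s w) b12 b2beta).
  rewrite /chord !free_energy_log_sum_exp; apply: le_trans.
  by rewrite le_eqVlt; apply/orP; left; apply/eqP; ring.
have h5 : beta / betac * (pressure betac + e / (beta / betac)) = Emax betac * beta + e.
  by rewrite annealed_pressure_critical//; field; rewrite !gt_eqF.
have := ler_wpM2l (ltW k0) h2; rewrite h5 => h6.
move: h1 hb; rewrite -/(chord pressure) !ler_norml => /andP[h7 h8] hb.
by apply/andP; split; lra.
Unshelve. all: by end_near. Qed.

End free_energy_limit.

Theorem theorem1 (R : realType) (d : measure_display) (T : measurableType d)
    (P : probability T R) (X : forall N : nat, config N -> {RV P >-> R})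
    (h : nat -> {RV P >-> R})
    (X_iid : forall N : nat, (0 < N)%N -> iid (X N))
    (X_gauss : forall N : nat, (0 < N)%N ->
       forall s : config N, centered_gaussian N%:R (X N s))
    (h_iid : iid h)
    (h_X_indep : forall N : nat, (0 < N)%N -> independent_families h (X N))
    (h_exp : forall t : R, ('E_P[fun w => expR (t * h 0%N w)%R] < +oo)%E) :
  (exists! betac : R, is_critical (h 0%N) betac) /\
  (forall betac : R, is_critical (h 0%N) betac ->
   forall beta : R, 0 < beta ->
     (beta <= betac ->
        {ae P, forall w, free_energy X h beta w @ \oo -->
           ln 2 + beta ^+ 2 / 2 + mean_log_cosh (h 0%N) beta}) /\
     (betac <= beta ->
        {ae P, forall w, free_energy X h beta w @ \oo -->
           max_energy (h 0%N) betac * beta})).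
Proof.
split; first exact: critical_exists_unique.
move=> betac /(is_criticalP (h 0%N))[c0 cE] beta beta0.
have super := free_energy_supercritical X_iid X_gauss h_iid h_X_indep h_exp c0 cE.
split=> [bc|]; last exact: super.
have [bltc|cleb] := ltP beta betac.
  exact: (free_energy_subcritical X_iid X_gauss h_iid h_X_indep h_exp cE).
have e : beta = betac by apply/eqP; rewrite eq_le bc.
have := super _ cleb; rewrite [X in X * _]/max_energy e mulrC.
by rewrite -/(max_energy _ _) -(annealed_pressure_critical cE).
Qed.
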